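(* Let $(\varepsilon_n)_{n\ge0}$ be an algorithmically random Rademacher sequence and let $(x_n)_{n\ge0}$, $(\phi_n)_{n\ge0}$ be computable sequences of real numbers. Set $$s_j=\left(\sum_{2^j\le n<2^{j+1}}x_n^2\right)^{1/2},\qquad j=0,1,2,\dots$$ If $(s_j)$ is a decreasing sequence and $\sum_{j=1}^{\infty}s_j$ is finite, then the Fourier series $$\sum_{n=0}^{\infty}\varepsilon_n x_n\cos(2\pi nt+\phi_n),\qquad t\in[0,1],$$ converges to a continuous function.
   Context: Write $\mathcal{N}=\{-1,1\}^{\omega}$ for the space of infinite sequences of $\pm1$. For $\alpha\in\mathcal{N}$ let $\overline{\alpha}(n)$ be its initial segment of length $n$. $K$ denotes (prefix-free, i.e. self-delimiting) Kolmogorov complexity of finite strings. A sequence $\alpha\in\mathcal{N}$ is Kolmogorov-Chaitin complex if there is $k$ such that $K(\overline{\alpha}(n))\ge n-k$ for all $n$; the set of such $\alpha$ is denoted $KC$. A sequence $(\varepsilon_n)$ is an algorithmically random Rademacher sequence if there is some $\alpha\in KC$ such that $\varepsilon_n\in\{-1,1\}$ is the $n$th bit of $\alpha$ for every $n$. A sequence $(x_n)$ of real numbers is a computable sequence if there is an effective way of approximating $x_n$ arbitrarily closely, given $n$. *)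

(* Defs.v *)
From HB Require Import structures.
From mathcomp Require Import all_boot all_order all_algebra.
From mathcomp Require Import all_classical all_reals all_analysis.
Set Implicit Arguments.
Unset Strict Implicit.
Unset Printing Implicit Defensive.
Import Order.TTheory GRing.Theory Num.Theory.
Import numFieldNormedType.Exports.
Local Open Scope classical_set_scope.
Local Open Scope ring_scope.

(* A partial function of n natural-number arguments is given by its graph.    *)
(* Only graphs of partial functions satisfy [partial_recursive].              *)
Inductive partial_recursive :
    forall n : nat, (n.-tuple nat -> nat -> Prop) -> Prop :=
| PR_zero : partial_recursive (fun (_ : 0.-tuple nat) y => y = 0%N)
| PR_succ : partial_recursive (fun (v : 1.-tuple nat) y => y = (thead v).+1)
| PR_proj (n : nat) (i : 'I_n) :
    partial_recursive (fun (v : n.-tuple nat) y => y = tnth v i)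
| PR_comp (n m : nat) (f : m.-tuple nat -> nat -> Prop)
      (g : 'I_m -> n.-tuple nat -> nat -> Prop) :
    partial_recursive f -> (forall i, partial_recursive (g i)) ->
    partial_recursive (fun (v : n.-tuple nat) y =>
      exists2 w : m.-tuple nat, forall i, g i v (tnth w i) & f w y)
(* The recursion variable is the first argument; h lists the successive       *)
(* values of the recursion.                                                   *)
| PR_rec (n : nat) (f : n.-tuple nat -> nat -> Prop)
      (g : n.+2.-tuple nat -> nat -> Prop) :
    partial_recursive f -> partial_recursive g ->
    partial_recursive (fun (v : n.+1.-tuple nat) y =>
      exists h : nat -> nat,
        [/\ f [tuple of behead v] (h 0%N),
            forall i, (i < thead v)%N ->
              g [tuple of i :: h i :: behead v] (h i.+1)
          & y = h (thead v)])
| PR_mu (n : nat) (f : n.+1.-tuple nat -> nat -> Prop) :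
    partial_recursive f ->
    partial_recursive (fun (v : n.-tuple nat) y =>
      f [tuple of y :: v] 0%N /\
      forall i, (i < y)%N -> exists z : nat, f [tuple of i :: v] z.+1).

Definition computable2 (f : nat -> nat -> nat) : Prop :=
  partial_recursive (fun (v : 2.-tuple nat) y =>
    y = f (tnth v ord0) (tnth v ord_max)).

(* Every rational is of the form (a - b) / (c + 1) with a, b, c natural.      *)
Definition computable_real_seq (R : realType) (x : nat -> R) : Prop :=
  exists a b c : nat -> nat -> nat,
    [/\ computable2 a, computable2 b, computable2 c
      & forall n k : nat,
          `|x n - ((a n k)%:R - (b n k)%:R) / (c n k).+1%:R| <= 2 ^- k].

(* Bijective base-2 numeration, a bijection between finite strings and nat.   *)
Definition string_code (s : seq bool) : nat :=
  foldr (fun (b : bool) (m : nat) => (m.*2 + b.+1)%N) 0%N s.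

(* The graph of a partial map from programs to output strings.                *)
Definition machine := seq bool -> seq bool -> Prop.

Definition computable_machine (M : machine) : Prop :=
  exists2 f : 1.-tuple nat -> nat -> Prop, partial_recursive f
    & forall p s, M p s <-> f [tuple string_code p] (string_code s).

Definition prefix_free (M : machine) : Prop :=
  forall p q s t, M p s -> M q t -> prefix p q -> p = q.

Definition prefix_machine (M : machine) : Prop :=
  computable_machine M /\ prefix_free M.

(* The reference machines with respect to which prefix-free Kolmogorov        *)
(* complexity is defined; two of them give the same complexity up to an       *)
(* additive constant.                                                         *)
Definition optimal_prefix_machine (U : machine) : Prop :=
  prefix_machine U /\
  forall M : machine, prefix_machine M ->
    exists c : nat, forall p s, M p s ->
      exists2 q, U q s & (size q <= size p + c)%N.

Definition has_program (U : machine) (s : seq bool) : pred nat :=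
  fun l => `[< exists2 p, size p = l & U p s >].

(* The default value 0 is never used when U is optimal: every string then has *)
(* a program.                                                                 *)
Definition K (U : machine) (s : seq bool) : nat :=
  if pselect (exists l, has_program U s l) is left h then ex_minn h else 0%N.

(* Elements of {-1, 1}^omega are coded as bool-valued sequences, with true    *)
(* for 1 and false for -1.                                                    *)
Definition initial_segment (alpha : nat -> bool) (n : nat) : seq bool :=
  mkseq alpha n.

Definition KC (U : machine) (alpha : nat -> bool) : Prop :=
  exists k : nat, forall n : nat, (n <= K U (initial_segment alpha n) + k)%N.

Definition random_rademacher (R : realType) (U : machine) (eps : nat -> R) :
    Prop :=
  exists2 alpha : nat -> bool, KC U alpha
    & forall n, eps n = if alpha n then 1 else -1.

Definition dyadic_norm (R : realType) (x : nat -> R) (j : nat) : R :=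
  Num.sqrt (\sum_(2 ^ j <= n < 2 ^ j.+1) x n ^+ 2).

(* Main.v *)
Require Import Defs.
From HB Require Import structures.
From mathcomp Require Import all_boot all_order all_algebra.
From mathcomp Require Import all_classical all_reals all_analysis.
From mathcomp Require Import ring lra zify.
Set Implicit Arguments.
Unset Strict Implicit.
Unset Printing Implicit Defensive.
Import Order.TTheory GRing.Theory Num.Theory.
Import numFieldNormedType.Exports.
Local Open Scope classical_set_scope.
Local Open Scope ring_scope.

(** The sequence of dyadic norms decreases and is summable, so by Cauchy
    condensation the series of [2 ^ k * s (2 ^ k)] converges. Cut the random
    series into the blocks of indices [2 ^ 2 ^ k <= n < 2 ^ 2 ^ k.+1]. The
    squared coefficients of block [k] add up to at most
    [2 ^ k * s (2 ^ k) ^ 2] (lemma [sum_sqr_block]), and a Rademacher sum with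
    coefficients [r n] exceeds the square root of [a * \sum r n ^ 2] in absolute
    value with probability at most [2 * exp (- a / 8)] (lemma
    [rademacher_deviation]). Put [N = 2 ^ 2 ^ k.+1] and [a = 128 * 2 ^ k]. The probability is then at
    most [2 * N ^ - 8], which leaves room for a union bound over the partial
    sums of the block, at most [N + 1] of them, and over a grid of
    [8 * N ^ 3 + 1] angles fine enough to control all the others. Thus, outside
    a set of sign patterns of probability at most [2 ^ - (2 * k)], every
    partial sum of block [k] is bounded, uniformly in the angle, by a constant
    times [2 ^ k * s (2 ^ k) + 2 ^ - k] (lemma [block_sum_le]). Including the
    partial sums in the union bound gives convergence of the whole series and
    not only of the sums over complete blocks; it costs little, because the
    logarithm of their number is of the same order [2 ^ k] as that of the number
    of angles.

    It remains to see that a complex sequence of signs avoids these exceptional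
    sets from some [k] on (lemma [KC_avoids_test]). Given [k], the exceptional
    set is a decidable set of strings of length [N] that contains a proportion
    at most [2 ^ - (2 * k)] of them. An element is therefore determined by [k]
    and by its rank in the set, which together take [N - k + 1] bits with [k]
    written in unary as a self-delimiting header; a sequence all of whose
    initial segments are incompressible up to a constant can lie in only
    finitely many of the sets.

    Decidability is obtained by testing, in place of the real coefficients
    [x n * cos (n * theta + phi n)], integers that approximate them on the scale
    [N ^ 2]; these are computed from the given approximations of [x] and [phi],
    the cosine by iterating the doubling formula on rational numbers. Taking the
    angles [theta], and not the times [t], on a rational grid keeps the number
    pi out of the computation.

    All functions that have to be computable are total functions on natural
    numbers, built from the given approximations by composition, primitive
    recursion and bounded sums; the partial functions of the definition enter only in the machine itself. *)

(** * Computable functions of several variables *)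

(** Argument lists are nested pairs: projections and extensions of such a list
    compute, so that the bodies of the functions below can be written with
    [v.1], [v.2.1], and so on, where tuples would need lemmas. *)
Fixpoint ctx (n : nat) : Type :=
  if n is n'.+1 then (nat * ctx n')%type else unit.

Fixpoint ctx_of (n : nat) : n.-tuple nat -> ctx n :=
  if n is n'.+1 then fun v => (thead v, ctx_of [tuple of behead v])
  else fun _ => tt.

Definition recursive (n : nat) (f : ctx n -> nat) : Prop :=
  partial_recursive (fun (v : n.-tuple nat) y => y = f (ctx_of v)).

Lemma eq_recursive n (f g : ctx n -> nat) :
  f =1 g -> recursive f -> recursive g.
Proof. by move=> /funext ->. Qed.

Lemma eq_partial_recursive n (F G : n.-tuple nat -> nat -> Prop) :
  (forall v y, F v y <-> G v y) -> partial_recursive F -> partial_recursive G.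
Proof.
move=> FG; suff -> : F = G by [].
by apply/funext => v; apply/funext => y; apply/propext.
Qed.

Lemma ctx_of_cons n (i : nat) (v : n.-tuple nat) :
  ctx_of [tuple of i :: v] = (i, ctx_of v).
Proof. by rewrite /= theadE; congr (_, ctx_of _); apply/val_inj. Qed.

Lemma tnth_behead_lift n (v : n.+1.-tuple nat) (j : 'I_n) :
  tnth [tuple of behead v] j = tnth v (lift ord0 j).
Proof.
by rewrite tnth_behead; congr (tnth _ _); apply/val_inj; rewrite /= inordK ?ltnS.
Qed.

Lemma recursive_v0 n : @recursive n.+1 (fun v => v.1).
Proof. exact: eq_partial_recursive (PR_proj (@ord0 n)). Qed.

(** [h] is the substitution that computes the arguments of [f]; passing it as
    a separate function lets the callers choose its syntactic form. *)
Lemma recursive_comp m n (f : ctx m -> nat) (g : 'I_m -> ctx n -> nat)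
    (h : ctx n -> ctx m) :
  recursive f -> (forall i, recursive (g i)) ->
  (forall v, h v = ctx_of [tuple g i v | i < m]) ->
  recursive (f \o h).
Proof.
move=> rf rg hE; apply: eq_partial_recursive (PR_comp rf rg) => v y; split.
  case=> w gw ->; rewrite /= hE; congr (f (ctx_of _)).
  by apply/eq_from_tnth => i; rewrite gw tnth_mktuple.
move=> ->; exists [tuple g i (ctx_of v) | i < m]; last by rewrite /= hE.
by move=> i; rewrite tnth_mktuple.
Qed.

Lemma ctx_of_tuple_cons n (F : 'I_n.+1 -> nat) :
  ctx_of [tuple F i | i < n.+1] = (F ord0, ctx_of [tuple F (lift ord0 i) | i < n]).
Proof.
rewrite -ctx_of_cons; congr ctx_of; apply/eq_from_tnth => i.
rewrite tnth_mktuple; case: (unliftP ord0 i) => [j|] ->.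
  by rewrite tnthS tnth_mktuple.
by rewrite tnth0.
Qed.

Fixpoint ctx_nth n : 'I_n -> ctx n -> nat :=
  if n is n'.+1 then fun i v => if unlift ord0 i is Some j then ctx_nth j v.2 else v.1
  else fun _ _ => 0%N.

Lemma ctx_nthE n (v : n.-tuple nat) i : ctx_nth i (ctx_of v) = tnth v i.
Proof.
elim: n v i => [v []//|n IHn v i] /=; case: (unliftP ord0 i) => [j|] -> //=.
by rewrite IHn tnth_behead_lift.
Qed.

Lemma ctx_nthK n (v : ctx n) : ctx_of [tuple ctx_nth i v | i < n] = v.
Proof.
elim: n v => [[]//|n IHn [i v]]; rewrite ctx_of_tuple_cons /= unlift_none /=.
congr (_, _); rewrite -[RHS]IHn; congr ctx_of.
by apply/eq_from_tnth => j; rewrite !tnth_mktuple liftK.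
Qed.

Lemma recursive_ctx_nth n (i : 'I_n) : recursive (ctx_nth i).
Proof.
by apply: eq_partial_recursive (PR_proj i) => v y; rewrite ctx_nthE.
Qed.

Lemma recursive_weaken n (f : ctx n -> nat) :
  recursive f -> recursive (fun v : ctx n.+1 => f v.2).
Proof.
move=> rf.
apply: (@recursive_comp n n.+1 f (fun i v => ctx_nth i v.2) (fun v => v.2)) => //.
  move=> i; apply: eq_recursive (recursive_ctx_nth (lift ord0 i)) => v /=.
  by rewrite liftK.
by move=> v; rewrite ctx_nthK.
Qed.

Lemma recursive_subst n (f : ctx n.+1 -> nat) (b : ctx n -> nat) :
  recursive f -> recursive b -> recursive (fun v : ctx n => f (b v, v)).
Proof.
move=> rf rb; pose g (i : 'I_n.+1) v :=
  if unlift ord0 i is Some j then ctx_nth j v else b v.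
apply: (@recursive_comp _ _ f g (fun v => (b v, v))) => //.
  move=> i; rewrite /g; case: (unliftP ord0 i) => [j|] _ //.
  exact: recursive_ctx_nth.
move=> v; rewrite ctx_of_tuple_cons /g unlift_none.
congr (_, _); rewrite -[LHS](ctx_nthK v); congr ctx_of.
by apply/eq_from_tnth => j; rewrite !tnth_mktuple liftK.
Qed.

(** Curried forms, in which computability hypotheses on functions such as the
    approximations of [x] and [phi] are most easily applied. *)
Definition recursive1 (f : nat -> nat) := recursive (fun v : ctx 1 => f v.1).
Definition recursive2 (f : nat -> nat -> nat) :=
  recursive (fun v : ctx 2 => f v.1 v.2.1).
Definition recursive3 (f : nat -> nat -> nat -> nat) :=
  recursive (fun v : ctx 3 => f v.1 v.2.1 v.2.2.1).

Lemma recursive_app1 n f (a : ctx n -> nat) :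
  recursive1 f -> recursive a -> recursive (fun v => f (a v)).
Proof.
move=> rf ra.
apply: (@recursive_comp 1 n _ (fun _ => a) (fun v => (a v, tt)) rf) => //.
by move=> v; rewrite ctx_of_tuple_cons.
Qed.

Lemma recursive_app2 n f (a b : ctx n -> nat) :
  recursive2 f -> recursive a -> recursive b ->
  recursive (fun v => f (a v) (b v)).
Proof.
move=> rf ra rb.
apply: (@recursive_comp 2 n _ (fun i => if i == ord0 then a else b)
  (fun v => (a v, (b v, tt))) rf).
  by move=> i; case: eqP.
by move=> v; rewrite 2!ctx_of_tuple_cons.
Qed.

Lemma recursive_app3 n f (a b c : ctx n -> nat) :
  recursive3 f -> recursive a -> recursive b -> recursive c ->
  recursive (fun v => f (a v) (b v) (c v)).
Proof.
move=> rf ra rb rc.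
apply: (@recursive_comp 3 n _ (fun i => if i == ord0 then a else
    if i == lift ord0 ord0 then b else c)
  (fun v => (a v, (b v, (c v, tt)))) rf).
  by move=> i; case: eqP => // _; case: eqP.
by move=> v; rewrite 3!ctx_of_tuple_cons.
Qed.

Lemma recursive_v1 n : @recursive n.+2 (fun v => v.2.1).
Proof. exact: recursive_weaken (recursive_v0 n). Qed.
Lemma recursive_v2 n : @recursive n.+3 (fun v => v.2.2.1).
Proof. exact: recursive_weaken (recursive_v1 n). Qed.
Lemma recursive_v3 n : @recursive n.+4 (fun v => v.2.2.2.1).
Proof. exact: recursive_weaken (recursive_v2 n). Qed.

Lemma recursive2_computable f : computable2 f -> recursive2 f.
Proof.
apply: eq_partial_recursive => v y /=.
suff -> : tnth v ord_max = thead [tuple of behead v] by [].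
by rewrite /thead tnth_behead_lift; congr (tnth _ _); apply/val_inj.
Qed.

Lemma recursive_succ n (a : ctx n -> nat) :
  recursive a -> recursive (fun v => (a v).+1).
Proof. by apply: recursive_app1; apply: PR_succ. Qed.

Lemma recursive_const n (c : nat) : recursive (fun _ : ctx n => c).
Proof.
elim: c => [|c IHc]; last exact: recursive_succ.
by apply: (@recursive_comp 0 n (fun _ => 0%N) (fun i _ => 0%N) (fun=> tt));
  [exact: PR_zero | case |].
Qed.

Fixpoint prim_rec (c : nat) (g : nat -> nat -> nat) (m : nat) : nat :=
  if m is m'.+1 then g m' (prim_rec c g m') else c.

(** The recursion scheme of the definition quantifies over the list of
    successive values; for a total step function this list is the restriction
    of [prim_rec]. *)
Lemma recursive_prim_rec n (f : ctx n -> nat) (g : nat -> nat -> ctx n -> nat)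
    (b : ctx n -> nat) :
  recursive f -> recursive (fun v : ctx n.+2 => g v.1 v.2.1 v.2.2) ->
  recursive b ->
  recursive (fun v => prim_rec (f v) (fun i y => g i y v) (b v)).
Proof.
move=> rf rg rb.
apply: (@recursive_subst n
  (fun w => prim_rec (f w.2) (fun i y => g i y w.2) w.1) b) => //.
apply: eq_partial_recursive (PR_rec rf rg) => v y; split; last first.
  move=> ->; exists (prim_rec (f (ctx_of v).2) (fun i y => g i y (ctx_of v).2)).
  split=> // i _; rewrite !ctx_of_cons /=.
  by congr (g _ _ (ctx_of _)); apply/val_inj.
case=> h [h0 hS ->] {y}.
have: (thead v <= thead v)%N by []; rewrite /=.
elim: {1 3 4}(thead v) => [//|i IHi] lti /=.
rewrite -IHi; last exact: ltnW.
rewrite hS // !ctx_of_cons /=.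
by congr (g _ _ (ctx_of _)); apply/val_inj.
Qed.

Lemma recursive_skip n (f : nat -> ctx n -> nat) :
  recursive (fun v : ctx n.+1 => f v.1 v.2) ->
  recursive (fun v : ctx n.+2 => f v.1 v.2.2).
Proof.
move=> rf; pose g (i : 'I_n.+1) (v : ctx n.+2) :=
  if unlift ord0 i is Some j then ctx_nth j v.2.2 else v.1.
apply: (@recursive_comp _ _ _ g (fun v => (v.1, v.2.2)) rf).
  move=> i; rewrite /g; case: (unliftP ord0 i) => [j|] _.
    exact: recursive_weaken (recursive_weaken (recursive_ctx_nth j)).
  exact: recursive_v0.
move=> v; rewrite ctx_of_tuple_cons /g unlift_none.
congr (_, _); rewrite -[LHS]ctx_nthK; congr ctx_of.
by apply/eq_from_tnth => j; rewrite !tnth_mktuple liftK.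
Qed.

Lemma recursive_add n (a b : ctx n -> nat) : recursive a -> recursive b ->
  recursive (fun v => a v + b v)%N.
Proof.
move=> ra rb.
apply: (@eq_recursive _ (fun v => prim_rec (b v) (fun _ y => y.+1) (a v))).
  by move=> v; elim: (a v) => //= m ->.
apply: recursive_prim_rec => //.
exact: recursive_succ (recursive_v1 _).
Qed.

Lemma recursive_pred n (a : ctx n -> nat) :
  recursive a -> recursive (fun v => (a v).-1).
Proof.
move=> ra; apply: (@eq_recursive _ (fun v => prim_rec 0 (fun i _ => i) (a v))).
  by move=> v; case: (a v).
apply: recursive_prim_rec => //; first exact: recursive_const.
exact: recursive_v0.
Qed.

Lemma recursive_sub n (a b : ctx n -> nat) : recursive a -> recursive b ->
  recursive (fun v => a v - b v)%N.
Proof.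
move=> ra rb.
apply: (@eq_recursive _ (fun v => prim_rec (a v) (fun _ y => y.-1) (b v))).
  by move=> v; elim: (b v) => [|m /= ->]; rewrite ?subn0 ?subnS.
apply: recursive_prim_rec => //.
exact: recursive_pred (recursive_v1 _).
Qed.

Lemma recursive_sum n (F : nat -> ctx n -> nat) (b : ctx n -> nat) :
  recursive (fun v : ctx n.+1 => F v.1 v.2) ->
  recursive b -> recursive (fun v => \sum_(0 <= i < b v) F i v)%N.
Proof.
move=> rF rb.
apply: (@eq_recursive _ (fun v => prim_rec 0 (fun i y => y + F i v)%N (b v))).
  move=> v; elim: (b v) => [|m /= ->]; first by rewrite big_nil.
  by rewrite big_nat_recr.
apply: recursive_prim_rec => //; first exact: recursive_const.
by apply: recursive_add; [exact: recursive_v1 | exact: recursive_skip].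
Qed.

Lemma recursive_mul n (a b : ctx n -> nat) : recursive a -> recursive b ->
  recursive (fun v => a v * b v)%N.
Proof.
move=> ra rb; apply: (@eq_recursive _ (fun v => \sum_(0 <= i < a v) b v)%N).
  by move=> v; rewrite sum_nat_const_nat subn0.
by apply: recursive_sum => //; apply: recursive_weaken.
Qed.

Lemma recursive_exp n (a b : ctx n -> nat) : recursive a -> recursive b ->
  recursive (fun v => a v ^ b v)%N.
Proof.
move=> ra rb.
apply: (@eq_recursive _ (fun v => prim_rec 1 (fun _ y => a v * y)%N (b v))).
  by move=> v; elim: (b v) => [|m /= ->]; rewrite ?expnS.
apply: recursive_prim_rec => //; first exact: recursive_const.
apply: recursive_mul; last exact: recursive_v1.
exact: recursive_weaken (recursive_weaken ra).
Qed.

Lemma recursive_neg n (P : ctx n -> bool) :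
  recursive P -> recursive (fun v => ~~ P v).
Proof.
move=> rP.
apply: (@eq_recursive _ (fun v => 1 - P v)%N); first by move=> v; case: (P v).
by apply: recursive_sub => //; apply: recursive_const.
Qed.

Lemma recursive_and n (P Q : ctx n -> bool) : recursive P -> recursive Q ->
  recursive (fun v => P v && Q v).
Proof.
move=> rP rQ; apply: (@eq_recursive _ (fun v => P v * Q v)%N).
  by move=> v; rewrite mulnb.
exact: recursive_mul.
Qed.

Lemma recursive_leq n (a b : ctx n -> nat) : recursive a -> recursive b ->
  recursive (fun v => (a v <= b v)%N).
Proof.
move=> ra rb; apply: (@eq_recursive _ (fun v => 1 - (a v - b v))%N).
  by move=> v; rewrite -subn_eq0; case: (a v - b v)%N.
by apply: recursive_sub (recursive_sub _ _) => //; apply: recursive_const.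
Qed.

Lemma recursive_if n (P : ctx n -> bool) (a b : ctx n -> nat) :
  recursive P -> recursive a -> recursive b ->
  recursive (fun v => if P v then a v else b v).
Proof.
move=> rP ra rb.
apply: (@eq_recursive _ (fun v => P v * a v + (1 - P v) * b v)%N).
  by move=> v; case: (P v); rewrite ?mul1n ?mul0n ?addn0.
apply: recursive_add; apply: recursive_mul => //.
by apply: recursive_sub => //; apply: recursive_const.
Qed.

Lemma recursive_has n (P : nat -> ctx n -> bool) (b : ctx n -> nat) :
  recursive (fun v : ctx n.+1 => P v.1 v.2) -> recursive b ->
  recursive (fun v => has (fun i => P i v) (index_iota 0 (b v))).
Proof.
move=> rP rb.
apply: (@eq_recursive _ (fun v => 0 < \sum_(0 <= i < b v) P i v)%N).
  move=> v; congr nat_of_bool; elim: (index_iota 0 (b v)) => [|i s IHs].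
    by rewrite big_nil.
  by rewrite big_cons /= -IHs; case: (P i v).
apply: recursive_leq; first exact: recursive_const.
by apply: recursive_sum.
Qed.

Lemma recursive_eq n (a b : ctx n -> nat) : recursive a -> recursive b ->
  recursive (fun v => a v == b v).
Proof.
move=> ra rb.
apply: (@eq_recursive _ (fun v => (a v <= b v) && (b v <= a v))%N).
  by move=> v; rewrite eqn_leq.
by apply: recursive_and; apply: recursive_leq.
Qed.

(** The quotient is the number of positive multiples of the divisor below the
    dividend; the factor [0 < b v] accounts for the convention [m %/ 0 = 0]. *)
Lemma recursive_div n (a b : ctx n -> nat) : recursive a -> recursive b ->
  recursive (fun v => a v %/ b v)%N.
Proof.
move=> ra rb.
apply: (@eq_recursive _ (fun v =>
  (0 < b v)%N * \sum_(0 <= i < a v) (i.+1 * b v <= a v))%N).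
  move=> v; case: (posnP (b v)) => [->|b0]; first by rewrite divn0.
  rewrite mul1n; under eq_bigr do rewrite -leq_divRL//.
  move: (a v %/ b v)%N (leq_div (a v) (b v)) => q.
  elim: (a v) => [|m IHm]; first by rewrite leqn0 => /eqP ->; rewrite big_nil.
  rewrite big_nat_recr //= leq_eqVlt => /predU1P[->|].
    rewrite leqnn (eq_big_nat _ _ (F2 := fun _ => 1%N)) => [|i /andP[_ im]].
      by rewrite sum_nat_const_nat subn0 muln1 addn1.
    by rewrite ltnW.
  by rewrite ltnS => dm; rewrite IHm // ltnNge dm addn0.
apply: recursive_mul; first by apply: recursive_leq => //; apply: recursive_const.
apply: recursive_sum => //; apply: recursive_leq; last exact: recursive_weaken.
apply: recursive_mul; last exact: recursive_weaken.
exact: recursive_succ (recursive_v0 _).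
Qed.

Lemma recursive_mod n (a b : ctx n -> nat) : recursive a -> recursive b ->
  recursive (fun v => a v %% b v)%N.
Proof.
move=> ra rb; apply: (@eq_recursive _ (fun v => a v - a v %/ b v * b v)%N).
  move=> v; apply: (@addnI (a v %/ b v * b v)%N).
  by rewrite -divn_eq subnKC ?leq_divM.
apply: recursive_sub => //; apply: recursive_mul => //; exact: recursive_div.
Qed.

(** The goal is matched syntactically before any lemma is applied: plain
    higher-order unification would try to evaluate the arithmetic operations. *)
Ltac recursive_step :=
  lazymatch goal with
  | |- recursive (fun _ => ?c) => exact: (recursive_const _ c)
  | |- recursive (fun v => v.1) => exact: recursive_v0
  | |- recursive (fun v => v.2.1) => exact: recursive_v1
  | |- recursive (fun v => v.2.2.1) => exact: recursive_v2
  | |- recursive (fun v => v.2.2.2.1) => exact: recursive_v3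
  | |- recursive (fun v => S (@?a v)) => apply (@recursive_succ _ a)
  | |- recursive (fun v => predn (@?a v)) => apply (@recursive_pred _ a)
  | |- recursive (fun v => addn (@?a v) (@?b v)) => apply (@recursive_add _ a b)
  | |- recursive (fun v => subn (@?a v) (@?b v)) => apply (@recursive_sub _ a b)
  | |- recursive (fun v => muln (@?a v) (@?b v)) => apply (@recursive_mul _ a b)
  | |- recursive (fun v => expn (@?a v) (@?b v)) => apply (@recursive_exp _ a b)
  | |- recursive (fun v => divn (@?a v) (@?b v)) => apply (@recursive_div _ a b)
  | |- recursive (fun v => modn (@?a v) (@?b v)) => apply (@recursive_mod _ a b)
  | |- recursive (fun v => nat_of_bool (leq (@?a v) (@?b v))) =>
      apply (@recursive_leq _ a b)
  | |- recursive (fun v => nat_of_bool (eq_op (@?a v) (@?b v))) =>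
      apply (@recursive_eq _ a b)
  | |- recursive (fun v => nat_of_bool (andb (@?a v) (@?b v))) =>
      apply (@recursive_and _ a b)
  | |- recursive (fun v => nat_of_bool (negb (@?a v))) =>
      apply (@recursive_neg _ a)
  | |- recursive (fun v => nat_of_bool
        (has (fun i => @?F v i) (index_iota 0 (@?b v)))) =>
      apply (@recursive_has _ (fun i v => F v i) b)
  | |- recursive (fun v => (\sum_(0 <= i < @?b v) (@?F v i))%N) =>
      apply (@recursive_sum _ (fun i v => F v i) b)
  | |- recursive (fun v => prim_rec (@?c v) (fun i y => @?F v i y) (@?b v)) =>
      apply (@recursive_prim_rec _ c (fun i y v => F v i y) b)
  | H : recursive1 ?f |- recursive (fun v => ?f (@?a v)) =>
      apply (@recursive_app1 _ f a H)
  | H : recursive2 ?f |- recursive (fun v => ?f (@?a v) (@?b v)) =>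
      apply (@recursive_app2 _ f a b H)
  | H : recursive2 (fun i j => nat_of_bool (?f i j))
      |- recursive (fun v => nat_of_bool (?f (@?a v) (@?b v))) =>
      apply (@recursive_app2 _ (fun i j => nat_of_bool (f i j)) a b H)
  | H : recursive3 ?f |- recursive (fun v => ?f (@?a v) (@?b v) (@?c v)) =>
      apply (@recursive_app3 _ f a b c H)
  end.

Ltac recursive_tac := repeat (cbv beta; cbn [fst snd]; recursive_step).

(** * Complex sequences avoid small decidable sets *)
Section BinaryPrograms.
Local Open Scope nat_scope.

(** The plain binary value, least significant bit first. It differs from
    [string_code s] by [2 ^ size s - 1], and is the form in which prefixes and
    single bits of a string can be read off by division. *)
Definition bits_value (s : seq bool) : nat :=
  foldr (fun (b : bool) m => b + m.*2) 0 s.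

Definition bits (n v : nat) : seq bool := mkseq (fun i => odd (v %/ 2 ^ i)) n.

Lemma bits_value_lt s : bits_value s < 2 ^ size s.
Proof. by elim: s => //= b s; rewrite expnS; case: b; lia. Qed.

Lemma string_codeE s : (string_code s).+1 = 2 ^ size s + bits_value s.
Proof. by elim: s => //= b s; rewrite /string_code/= -/(string_code s) expnS; lia. Qed.

Lemma bits_valueK s : bits (size s) (bits_value s) = s.
Proof.
elim: s => //= b s IHs; rewrite /bits /mkseq /= expn0 divn1 oddD odd_double addbF oddb.
congr (_ :: _); rewrite -[RHS]IHs (iotaDl 1 0) -map_comp; apply: eq_map => i /=.
rewrite add1n expnS divnMA divn2; congr (odd (_ %/ _)); case: b; lia.
Qed.

Lemma bitsK n v : v < 2 ^ n -> bits_value (bits n v) = v.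
Proof.
elim: n v => [|n IHn] v; first by rewrite ltnS leqn0 => /eqP ->.
move=> vn; rewrite /bits /mkseq /= expn0 divn1 (iotaDl 1 0) -map_comp.
rewrite (_ : map _ _ = bits n v./2).
  by rewrite IHn ?odd_double_half//; move: vn; rewrite expnS; lia.
by apply: eq_map => i /=; rewrite add1n expnS divnMA divn2.
Qed.

Lemma nth_bits_value s i : i < size s ->
  nth false s i = odd (bits_value s %/ 2 ^ i).
Proof. by move=> si; rewrite -[in LHS](bits_valueK s) nth_mkseq. Qed.

Lemma bits_value_cat s t :
  bits_value (s ++ t) = bits_value s + 2 ^ size s * bits_value t.
Proof. by elim: s => /= [|b s ->]; rewrite ?mul1n // expnS; lia. Qed.

Lemma size_bits n v : size (bits n v) = n.
Proof. exact: size_mkseq. Qed.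

Lemma expn2_uniq n m v : 2 ^ n <= v < 2 ^ n.+1 -> 2 ^ m <= v < 2 ^ m.+1 -> n = m.
Proof.
move=> /andP[nv vn] /andP[mv vm]; apply/eqP; rewrite eqn_leq.
have := leq_ltn_trans nv vm; have := leq_ltn_trans mv vn.
by rewrite !ltn_exp2l // !ltnS => -> ->.
Qed.

(** Read from the least significant end, [v] begins with [k] ones followed by
    a zero: the self-delimiting code of [k] at the start of a program. *)
Definition has_header (k v : nat) : bool := v %% 2 ^ k.+1 == (2 ^ k).-1.

(** Modulo [2 ^ k.+1], for the smaller [k], the longer header consists of ones
    only. *)
Lemma has_header_uniq k l v : has_header k v -> has_header l v -> k = l.
Proof.
wlog kl : k l / k <= l => [wl|].
  by case: (leqP k l) => [/wl //|/ltnW /wl kl hk hl]; rewrite kl.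
move: kl; rewrite leq_eqVlt => /predU1P[//|kl] /eqP hk /eqP hl.
have: (2 ^ l).-1 %% 2 ^ k.+1 = (2 ^ k).-1.
  by rewrite -hl -hk modn_dvdm // dvdn_exp2l // ltnS ltnW.
have -> : (2 ^ l).-1 = (2 ^ (l - k.+1) ).-1 * 2 ^ k.+1 + (2 ^ k.+1).-1.
  rewrite -{1}(subnK kl) expnD.
  have := expn_gt0 2 k.+1; have := expn_gt0 2 (l - k.+1).
  by case: (2 ^ (l - k.+1)) (2 ^ k.+1) => [|a] // [|b] // _ _; rewrite mulSn; lia.
rewrite modnMDl modn_small ?prednK ?expn_gt0 //.
by have := expn_gt0 2 k; rewrite expnS; lia.
Qed.

(** For [v = 2 ^ n] this counts the strings of length [n] that satisfy [P]. *)
Definition rank (P : pred nat) (v : nat) : nat := \sum_(0 <= u < v) P u.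

Lemma rank_lt (P : pred nat) u v : P u -> u < v -> rank P u < rank P v.
Proof.
move=> Pu uv; rewrite /rank [ltnRHS](big_cat_nat (n := u.+1)) //.
by rewrite [in ltnRHS]big_nat_recr //= Pu; lia.
Qed.

Lemma rank_inj (P : pred nat) u v : P u -> P v -> rank P u = rank P v -> u = v.
Proof.
move=> Pu Pv ruv; case: (ltngtP u v) => // /(@rank_lt P).
  by move=> /(_ Pu); rewrite ruv ltnn.
by move=> /(_ Pv); rewrite ruv ltnn.
Qed.

Lemma K_le (U : machine) q s : U q s -> K U s <= size q.
Proof.
move=> Uq; rewrite /K; case: pselect => [h|[]]; last first.
  by exists (size q); apply/asboolP; exists q.
by case: ex_minnP => m _; apply; apply/asboolP; exists q.
Qed.

Lemma string_code_surj i : exists s, string_code s = i.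
Proof.
have [n /andP[ni iN]] : exists n, (2 ^ n <= i.+1) && (i.+1 < 2 ^ n.+1).
  by exists (trunc_log 2 i.+1); rewrite trunc_logP // trunc_log_ltn.
exists (bits n (i.+1 - 2 ^ n)); apply: succn_inj.
rewrite string_codeE size_bits bitsK ?subnKC //.
by rewrite ltn_subLR // addnn -mul2n -expnS.
Qed.

(** [E k] is a set of strings of length [N k], each given by its value. *)
Section Test.
Variables (E : nat -> nat -> bool) (N : nat -> nat).
Hypothesis recE : recursive2 E.
Hypothesis recN : recursive1 N.
Hypothesis N_ge : forall k, k.*2 <= N k.

(* Length of the programs: a header of [k + 1] bits, then [N k - 2 * k] bits
   that hold a rank in [E k]. *)
Let L k := N k - k + 1.

(** The program of code [p] consists of the header of [k] and of the rank in
    [E k] of the string of code [s]. The condition bears on codes and not on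
    strings, because it has to be computable. *)
Definition decodes k p s := [&& 2 ^ L k <= p.+1, p.+1 < 2 ^ (L k).+1,
  has_header k (p.+1 - 2 ^ L k),
  2 ^ N k <= s.+1, s.+1 < 2 ^ (N k).+1,
  E k (s.+1 - 2 ^ N k)
  & rank (E k) (s.+1 - 2 ^ N k) == (p.+1 - 2 ^ L k) %/ 2 ^ k.+1].

Definition test_machine : machine := fun p s =>
  exists k, decodes k (string_code p) (string_code s).

Lemma test_lengthE k : L k = N k - k.*2 + k.+1.
Proof. by rewrite /L; have := N_ge k; lia. Qed.

Lemma string_code_bounds s l :
  (2 ^ l <= (string_code s).+1) && ((string_code s).+1 < 2 ^ l.+1) = (size s == l).
Proof.
rewrite string_codeE; apply/idP/eqP => [sl|<-]; last first.
  by rewrite leq_addr expnS mul2n -addnn ltn_add2l bits_value_lt.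
apply: expn2_uniq sl.
by rewrite leq_addr expnS mul2n -addnn ltn_add2l bits_value_lt.
Qed.

Lemma decodesE k p s : decodes k (string_code p) (string_code s) =
  [&& size p == L k, has_header k (bits_value p), size s == N k,
    E k (bits_value s) & rank (E k) (bits_value s) == bits_value p %/ 2 ^ k.+1].
Proof.
rewrite /decodes.
do 2![rewrite andbA string_code_bounds; case: eqP => //= <-;
  rewrite string_codeE addKn; case: has_header => //=].
Qed.

Lemma decodes_bound k p s : decodes k p s -> k < p.+1.
Proof.
case/andP=> Lp _; rewrite ltnS -ltnS (leq_trans _ Lp) //.
have kL : k <= L k by rewrite /L; have := N_ge k; lia.
by rewrite (leq_ltn_trans kL) // ltn_expl.
Qed.

(** The header lies in the common prefix, so both programs have the same [k],
    hence the same length; the rank then determines the output. This gives both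
    prefix-freeness and the uniqueness of the output. *)
Lemma decodes_functional k l p q s t :
  decodes k (string_code p) (string_code s) ->
  decodes l (string_code q) (string_code t) -> prefix p q -> p = q /\ s = t.
Proof.
rewrite !decodesE => /and5P[/eqP Lp hp /eqP Ns Es /eqP rs].
move=> /and5P[/eqP Lq hq /eqP Nt Et /eqP rt] /prefixP[u qE].
have kl : k = l.
  apply: (has_header_uniq _ hq); move: hp; rewrite qE bits_value_cat /has_header.
  suff /dvdnP[m ->] : 2 ^ k.+1 %| 2 ^ size p by rewrite mulnAC addnC modnMDl.
  by rewrite dvdn_exp2l // Lp test_lengthE leq_addl.
subst l; have pq : p = q.
  suff /size0nil u0 : size u = 0 by rewrite qE u0 cats0.
  by move/eqP: Lq; rewrite qE size_cat Lp -[eqbRHS]addn0 eqn_add2l => /eqP.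
split=> //; rewrite -(bits_valueK s) -(bits_valueK t) Ns Nt.
by congr bits; apply: rank_inj Es Et _; rewrite rs rt pq.
Qed.

(** The output is found by unbounded search; since it is unique, the least
    solution found by the search is the only one. *)
Lemma test_machine_computable : computable_machine test_machine.
Proof.
pose G s p := has (fun k => decodes k p s) (index_iota 0 p.+1).
have GP s p : reflect (exists k, decodes k p s) (G s p).
  apply: (iffP hasP) => [[k _ ?]|[k kp]]; exists k => //.
  by rewrite mem_index_iota (decodes_bound kp).
have recG : recursive2 (fun s p => ~~ G s p).
  by rewrite /recursive2 /G /decodes /has_header /rank /L; recursive_tac.
eexists; first exact: PR_mu recG.
move=> p s; rewrite /= !theadE /=; split=> [/GP Gps|[]]; last first.
  by move=> /esym/eqP; rewrite eqb0 negbK => /GP.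
rewrite Gps; split=> // i i_s; exists 0; rewrite !theadE /=; case: (GP i _) => // -[l li].
have /GP[k ks] := Gps; have [t tE] : exists t, string_code t = i.
  exact: string_code_surj.
move: i_s li; rewrite -tE => ts /(decodes_functional ks).
by rewrite prefix_refl => /(_ isT)[_ e]; rewrite e ltnn in ts.
Qed.

Lemma test_machine_prefix : prefix_machine test_machine.
Proof.
split; first exact: test_machine_computable.
by move=> p q s t [k kp] [l lq] /(decodes_functional kp lq)[].
Qed.

(** A member of [E k] has a program of length [N k - k + 1], which is too short
    for an initial segment of a complex sequence as soon as [k] exceeds the sum
    of the two constants by at least two. *)
Lemma KC_avoids_test (U : machine) (alpha : nat -> bool) :
  optimal_prefix_machine U -> KC U alpha ->
  (forall k, rank (E k) (2 ^ N k) * 2 ^ k.*2 <= 2 ^ N k) ->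
  exists k0, forall k, k0 <= k -> ~~ E k (bits_value (initial_segment alpha (N k))).
Proof.
move=> [_ /(_ _ test_machine_prefix)[c Uc]] [d Kd] small.
exists (c + d + 2) => k k0; apply/negP => Ek.
set s := initial_segment _ _ in Ek; have sN : size s = N k by rewrite size_mkseq.
set r := rank (E k) (bits_value s).
have rN : r < 2 ^ (N k - k.*2).
  rewrite -(ltn_pmul2r (expn_gt0 2 k.*2)) -expnD subnK //.
  apply: leq_trans (small k); rewrite ltn_pmul2r ?expn_gt0 //.
  by apply: rank_lt => //; rewrite -sN bits_value_lt.
pose v := (2 ^ k).-1 + r * 2 ^ k.+1.
have k1 : (2 ^ k).-1 < 2 ^ k.+1.
  by rewrite expnS mul2n -addnn; have := expn_gt0 2 k; lia.
have vL : v < 2 ^ L k.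
  rewrite test_lengthE expnD (@leq_trans (r.+1 * 2 ^ k.+1)) //.
    by rewrite /v mulSn ltn_add2r.
  by rewrite leq_pmul2r ?expn_gt0.
have : test_machine (bits (L k) v) s.
  exists k; rewrite decodesE size_bits eqxx bitsK // sN eqxx Ek /=.
  rewrite /has_header /v addnC modnMDl modn_small // eqxx /=.
  by rewrite divnMDl ?expn_gt0 // divn_small // addn0.
case/Uc=> q /K_le Kq; rewrite size_bits test_lengthE => qL.
by have := Kd (N k); rewrite -/s; have := N_ge k; lia.
Qed.

End Test.

End BinaryPrograms.

(** * Cosine by angle doubling *)

Lemma cos_lipschitz (R : realType) (a b : R) : `|cos a - cos b| <= `|a - b|.
Proof.
wlog ab : a b / b <= a => [wl|].
  by case/orP: (le_total b a) => /wl //; rewrite (distrC b) (distrC (cos b)).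
have [|c _ ->] := @MVT_segment R cos (fun x => - sin x) b a ab _.
  by apply: continuous_subspaceT => x; exact: continuous_cos.
by rewrite normrM normrN ler_piMl // sin_max.
Qed.

Lemma norm_sin_le (R : realType) (u : R) : `|sin u| <= `|u|.
Proof.
have := cos_lipschitz (u - pi / 2) (- (pi / 2)).
by rewrite cosBpihalf cosN cos_pihalf subr0 opprK subrK.
Qed.

Lemma sin_approx (R : realType) (u : R) : `|sin u - u| <= u ^+ 2.
Proof.
wlog u0 : u / 0 <= u => [wl|].
  case/orP: (le_total 0 u) => [/wl //|u0]; rewrite -sqrrN.
  have := wl (- u); rewrite sinN -opprD normrN; apply; lra.
have [|c] := @MVT_segment R (fun x => sin x - x) (fun x => cos x - 1) 0 u u0 _.
  apply: continuous_subspaceT => x; apply: cvgB; first exact: continuous_sin.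
  exact: cvg_id.
rewrite in_itv /= sin0 !subr0 => /andP[c0 cu] ->.
rewrite normrM (ger0_norm u0) expr2 ler_wpM2r // -(cos0 R).
by rewrite (le_trans (cos_lipschitz _ _)) // subr0 ger0_norm.
Qed.

Fixpoint cos_doubling (R : realType) (h : R) (m : nat) : R :=
  if m is m'.+1 then 2 * cos_doubling h m' ^+ 2 - 1 else 1 - h ^+ 2 / 2.

(** The initial error is of order [h ^ 3], and each doubling multiplies the
    error by at most 4, because both values stay in [-1, 1]. With [h] equal to
    [u / 2 ^ m] the final error is at most [`|u| ^ 3 / 2 ^ m]. *)
Lemma cos_doubling_approx (R : realType) (h : R) (m : nat) : `|h| <= 1 ->
  `|cos_doubling h m| <= 1 /\
  `|cos_doubling h m - cos (2 ^+ m * h)| <= 4 ^+ m * `|h| ^+ 3.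
Proof.
move=> h1; elim: m => [|m [c1 ce]] /=.
  split.
    have : h ^+ 2 <= 1 by rewrite -(real_normK (num_real _)) expr_le1.
    by have := sqr_ge0 h; move: (h ^+ 2) => t; rewrite ler_norml; lra.
  rewrite !expr0 !mul1r.
  have [u {h h1}->] : exists u, h = u *+ 2 by exists (h / 2); rewrite mulr2n -splitr.
  rewrite cos_mulr2n cos2sin2.
  have -> : 1 - (u *+ 2) ^+ 2 / 2 - ((1 - sin u ^+ 2) *+ 2 - 1) =
      2 * ((sin u - u) * (sin u + u)).
    by move: (sin u) => s; rewrite !mulr2n; field.
  rewrite !normrM ger0_norm // normrMn exprMn_n.
  have su := sin_approx u; have sv := norm_sin_le u.
  have sw : `|sin u + u| <= 2 * `|u| by rewrite (le_trans (ler_normD _ _)) //; lra.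
  rewrite -(real_normK (num_real _)) in su.
  have := ler_pM (normr_ge0 _) (normr_ge0 _) su sw.
  have : 0 <= `|u| ^+ 3 by [].
  have -> : `|u| ^+ 2 * (2 * `|u|) = 2 * `|u| ^+ 3 by rewrite exprS; ring.
  by move: (`|u| ^+ 3) (_ * `|sin u + u|) => s t s0 t0; rewrite !mulr2n; lra.
set c := cos_doubling h m in c1 ce *.
have [cl cu] : -1 <= c /\ c <= 1 by apply/andP; rewrite -ler_norml.
have c2 : c ^+ 2 <= 1 by rewrite -(real_normK (num_real _)) expr_le1.
split; first by have := sqr_ge0 c; move: (c ^+ 2) c2 => s; rewrite ler_norml; lra.
rewrite (exprS 2 m) -mulrA (mulr_natl (2 ^+ m * h) 2) cos_mulr2n.
move: c (cos _) (cos_max (2 ^+ m * h)) ce c1 {cl cu c2} => c d d1 ce c1.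
have -> : 2 * c ^+ 2 - 1 - (d ^+ 2 *+ 2 - 1) = 2 * ((c - d) * (c + d)).
  by rewrite mulr2n; ring.
have cd : `|c + d| <= 2.
  by rewrite (le_trans (ler_normD _ _)) // (_ : 2 = 1 + 1) // lerD //.
rewrite !normrM ger0_norm // (exprS 4 m) -mulrA.
have := ler_pM (normr_ge0 _) (normr_ge0 _) ce cd.
move: (`|c - d| * _) => s; move: (4 ^+ m * _) => t; lra.
Qed.

(** * Computable families of real numbers *)

(** Used to raise the precision, the first argument of the approximations. *)
Lemma recursive_at n (p e : ctx n.+1 -> nat) :
  recursive p -> recursive e -> recursive (fun w : ctx n.+1 => p (e w, w.2)).
Proof.
move=> rp re.
apply: (@recursive_subst n.+1 (fun w => p (w.1, w.2.2)) e) => //.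
apply: (@recursive_skip n (fun i v => p (i, v))).
by apply: eq_recursive rp => -[].
Qed.

Lemma natr_le_exp2 (R : realType) (b : nat) : b%:R <= 2 ^+ b :> R.
Proof. by rewrite -natrX ler_nat ltnW // ltn_expl. Qed.

Lemma scaled_exp2 (R : realType) (k b : nat) (c : R) :
  c <= b%:R -> c * 2 ^- (k + b) <= 2 ^- k.
Proof.
move=> cb; rewrite exprD invfM mulrCA ler_piMr ?invr_ge0 ?exprn_ge0 //.
by rewrite ler_pdivrMr ?exprn_gt0 // mul1r (le_trans cb) // natr_le_exp2.
Qed.

(** A uniformly computable family of reals. The precision is the first argument
    of the approximations, so that it can be adjusted by substitution. *)
Definition computable_real (R : realType) n (u : ctx n -> R) : Prop :=
  exists p q d : ctx n.+1 -> nat, [/\ recursive p, recursive q, recursive d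
    & forall k v, `|u v - ((p (k, v))%:R - (q (k, v))%:R) / (d (k, v)).+1%:R|
        <= 2 ^- k].

Section ComputableReal.
Variables (R : realType) (n : nat).

Lemma computable_real_ratio (a b : ctx n -> nat) : recursive a -> recursive b ->
  computable_real (fun v => (a v)%:R / (b v).+1%:R : R).
Proof.
move=> ra rb; exists (fun w => a w.2), (fun=> 0%N), (fun w => b w.2); split.
- exact: recursive_weaken.
- exact: recursive_const.
- exact: recursive_weaken.
by move=> k v /=; rewrite subr0 subrr normr0 invr_ge0 exprn_ge0.
Qed.

Lemma computable_real_of_seq (x : nat -> R) (a : ctx n -> nat) :
  computable_real_seq x -> recursive a -> computable_real (fun v => x (a v)).
Proof.
case=> p [q [d [/recursive2_computable rp /recursive2_computable rq
  /recursive2_computable rd xE]]] ra.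
exists (fun w => p (a w.2) w.1), (fun w => q (a w.2) w.1), (fun w => d (a w.2) w.1).
have ra' := recursive_weaken ra; have r0 := recursive_v0 n.
by split; try exact: recursive_app2.
Qed.

Lemma computable_real_add (u w : ctx n -> R) :
  computable_real u -> computable_real w -> computable_real (fun v => u v + w v).
Proof.
case=> p [q [d [rp rq rd uE]]] [p' [q' [d' [rp' rq' rd' wE]]]].
have at1 := fun f rf => @recursive_at n f (fun w => w.1.+1) rf
  (recursive_succ (recursive_v0 n)).
pose P (w : ctx n.+1) := p (w.1.+1, w.2).
pose P' (w : ctx n.+1) := p' (w.1.+1, w.2).
pose Q (w : ctx n.+1) := q (w.1.+1, w.2).
pose Q' (w : ctx n.+1) := q' (w.1.+1, w.2).
pose D (w : ctx n.+1) := d (w.1.+1, w.2).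
pose D' (w : ctx n.+1) := d' (w.1.+1, w.2).
have [rP rP'] : recursive P /\ recursive P' by split; exact: at1.
have [rQ rQ'] : recursive Q /\ recursive Q' by split; exact: at1.
have [rD rD'] : recursive D /\ recursive D' by split; exact: at1.
exists (fun w : ctx n.+1 => P w * (D' w).+1 + P' w * (D w).+1)%N,
  (fun w : ctx n.+1 => Q w * (D' w).+1 + Q' w * (D w).+1)%N,
  (fun w : ctx n.+1 => ((D w).+1 * (D' w).+1).-1)%N.
split.
- by recursive_tac.
- by recursive_tac.
- by recursive_tac.
move=> k v; rewrite prednK // !natrD !natrM.
set t := (_ / _); have -> : t = ((P (k, v))%:R - (Q (k, v))%:R) / (D (k, v)).+1%:R +
    ((P' (k, v))%:R - (Q' (k, v))%:R) / (D' (k, v)).+1%:R.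
  rewrite /t; have : (D (k, v)).+1%:R != 0 :> R by rewrite pnatr_eq0.
  have : (D' (k, v)).+1%:R != 0 :> R by rewrite pnatr_eq0.
  move: (D (k, v)).+1%:R (D' (k, v)).+1%:R => a b b0 a0.
  by field; rewrite ?a0 ?b0.
rewrite opprD addrACA (le_trans (ler_normD _ _)) //.
rewrite (le_trans (lerD (uE k.+1 v) (wE k.+1 v))) //.
by rewrite exprS invfM; lra.
Qed.

Lemma computable_real_mul (u w : ctx n -> R) :
  computable_real u -> computable_real w -> computable_real (fun v => u v * w v).
Proof.
case=> p [q [d [rp rq rd uE]]] [p' [q' [d' [rp' rq' rd' wE]]]].
(* The approximation at precision 0 bounds the number itself; the extra
   precision in [e] absorbs these bounds. *)
pose B (w : ctx n.+1) := (p (0, w.2) + q (0, w.2)).+1%N.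
pose B' (w : ctx n.+1) := (p' (0, w.2) + q' (0, w.2)).+1%N.
pose e (w : ctx n.+1) := (w.1 + (B w + B' w).+1)%N.
have at0 := fun f rf => @recursive_at n f (fun w => 0%N) rf (recursive_const _ 0).
have re : recursive e by rewrite /e /B /B'; recursive_tac; exact: at0.
have at1 := fun f rf => @recursive_at n f e rf re.
pose P (w : ctx n.+1) := p (e w, w.2).
pose P' (w : ctx n.+1) := p' (e w, w.2).
pose Q (w : ctx n.+1) := q (e w, w.2).
pose Q' (w : ctx n.+1) := q' (e w, w.2).
pose D (w : ctx n.+1) := d (e w, w.2).
pose D' (w : ctx n.+1) := d' (e w, w.2).
have [rP rP'] : recursive P /\ recursive P' by split; exact: at1.
have [rQ rQ'] : recursive Q /\ recursive Q' by split; exact: at1.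
have [rD rD'] : recursive D /\ recursive D' by split; exact: at1.
exists (fun w : ctx n.+1 => P w * P' w + Q w * Q' w)%N,
  (fun w : ctx n.+1 => P w * Q' w + Q w * P' w)%N,
  (fun w : ctx n.+1 => ((D w).+1 * (D' w).+1).-1)%N.
split.
- by recursive_tac.
- by recursive_tac.
- by recursive_tac.
move=> k v; rewrite prednK // !natrD !natrM.
have := uE (e (k, v)) v; have := wE (e (k, v)) v.
rewrite -/(P (k, v)) -/(Q (k, v)) -/(D (k, v)).
rewrite -/(P' (k, v)) -/(Q' (k, v)) -/(D' (k, v)).
set s := (_ / (D (k, v)).+1%:R); set s' := (_ / (D' (k, v)).+1%:R) => ws us.
set t := (_ / _); have -> : t = s * s'.
  rewrite /t /s /s'; have : (D (k, v)).+1%:R != 0 :> R by rewrite pnatr_eq0.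
  have : (D' (k, v)).+1%:R != 0 :> R by rewrite pnatr_eq0.
  move: (D (k, v)).+1%:R (D' (k, v)).+1%:R => a b b0 a0.
  by field; rewrite ?a0 ?b0.
clearbody s s'.
have bound (x : R) (a b c : nat) : `|x - (a%:R - b%:R) / c.+1%:R| <= 2 ^- 0 ->
    `|x| <= (a + b).+1%:R.
  rewrite expr0 invr1 => xab.
  rewrite -(subrK ((a%:R - b%:R) / c.+1%:R) x) (le_trans (ler_normD _ _)) //.
  rewrite -[leRHS]natr1 addrC lerD // normrM normfV [`|c.+1%:R|]ger0_norm //.
  rewrite ler_pdivrMr ?ltr0n // (le_trans (ler_normB _ _)) // !ger0_norm // natrD.
  by rewrite ler_peMr ?addr_ge0 // ler1n.
have {bound}[uB wB] : `|u v| <= (B (k, v))%:R /\ `|w v| <= (B' (k, v))%:R.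
  by split; [exact: bound (uE 0%N v) | exact: bound (wE 0%N v)].
have le1 : 2 ^- e (k, v) <= 1 :> R.
  by rewrite invf_le1 ?exprn_gt0 // exprn_ege1 // ler1n.
have sB : `|s| <= (B (k, v))%:R + 1.
  rewrite -(subrK (u v) s) (le_trans (ler_normD _ _)) // addrC lerD //.
  by rewrite distrC (le_trans us).
have -> : u v * w v - s * s' = (u v - s) * w v + s * (w v - s') by ring.
rewrite (le_trans (ler_normD _ _)) // !normrM.
have := ler_pM (normr_ge0 _) (normr_ge0 _) us wB.
have := ler_pM (normr_ge0 _) (normr_ge0 _) sB ws.
have : (B (k, v) + B' (k, v)).+1%:R * 2 ^- e (k, v) <= 2 ^- k :> R.
  exact: scaled_exp2 (lexx _).
rewrite -natr1 natrD.
move: (_ * `|w v - s'|) (_ * `|w v|) => y z.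
by move: (2 ^- e (k, v)) (2 ^- k) => a b; lra.
Qed.

Definition natdist (a b : nat) : nat := ((a - b) + (b - a))%N.

Lemma natr_natdist (a b : nat) : (natdist a b)%:R = `|a%:R - b%:R| :> R.
Proof.
rewrite /natdist; case: (leqP a b) => [ab|/ltnW ab].
  rewrite (eqP ab) add0n natrB // distrC ger0_norm // subr_ge0 ler_nat //.
by rewrite (eqP ab) addn0 natrB // ger0_norm // subr_ge0 ler_nat.
Qed.

Lemma recursive_natdist m (a b : ctx m -> nat) : recursive a -> recursive b ->
  recursive (fun v => natdist (a v) (b v)).
Proof. by move=> ra rb; rewrite /natdist; recursive_tac. Qed.

(** Numerator of the absolute value of [cos_doubling] when the start is [a / b]:
    only squares enter the next step, so the sign need not be carried, and the
    denominator after [m] steps is [b ^ (2 ^ m)]. *)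
Definition doubling_numerator (a b m : nat) : nat :=
  prim_rec a (fun j y => natdist (2 * y ^ 2) ((b ^ (2 ^ j)) ^ 2))%N m.

Lemma cos_doubling_numerator (h : R) (a b m : nat) : (0 < b)%N ->
  1 - h ^+ 2 / 2 = a%:R / b%:R ->
  `|cos_doubling h m| = (doubling_numerator a b m)%:R / (b ^ (2 ^ m))%:R.
Proof.
move=> b0 h0; elim: m => [|m IHm] /=.
  by rewrite h0 expn0 expn1 ger0_norm // divr_ge0.
have c0 : ((b ^ (2 ^ m))%:R : R) != 0 by rewrite pnatr_eq0 -lt0n expn_gt0 b0.
rewrite -(real_normK (num_real (cos_doubling h m))) IHm.
rewrite natr_natdist (expnSr 2 m) (expnM b) natrM !(natrX _ _ 2).
rewrite -/(doubling_numerator a b m).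
move: (doubling_numerator a b m)%:R (_ ^ _)%:R c0 => x c c0.
have -> : 2 * (x / c) ^+ 2 - 1 = (2 * x ^+ 2 - c ^+ 2) / c ^+ 2 by field.
by rewrite normrM normfV (ger0_norm (sqr_ge0 c)).
Qed.

(** The argument is replaced by a rational [rho] at precision [k + 1], and the
    cosine of [rho] is computed by halving [rho] sufficiently often. The last of
    the doublings is done on the numerators with its sign. *)
Lemma computable_real_cos (u : ctx n -> R) :
  computable_real u -> computable_real (fun v => cos (u v)).
Proof.
case=> p [q [d [rp rq rd uE]]].
have at1 := fun f rf => @recursive_at n f (fun w => w.1.+1) rf
  (recursive_succ (recursive_v0 n)).
pose B (w : ctx n.+1) := natdist (p (w.1.+1, w.2)) (q (w.1.+1, w.2)).
have rB : recursive B by apply: recursive_natdist; exact: at1.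
(* [B] bounds [`|rho|], hence [`|rho| ^ 3] is at most [2 ^ (3 * B)]: after
   halving [rho] [m + 1] times the final error is at most [2 ^ - k.+1]. *)
pose m (w : ctx n.+1) := (w.1.+1 + 3 * B w)%N.
pose S (w : ctx n.+1) := ((d (w.1.+1, w.2)).+1 * 2 ^ (m w).+1)%N.
have rd1 := at1 _ rd.
have rm : recursive m by rewrite /m; recursive_tac.
have rS : recursive S by rewrite /S; recursive_tac.
pose A (w : ctx n.+1) :=
  doubling_numerator (2 * S w ^ 2 - B w ^ 2) (2 * S w ^ 2) (m w).
pose D (w : ctx n.+1) := ((2 * S w ^ 2) ^ (2 ^ m w))%N.
have rD : recursive D by rewrite /D; recursive_tac.
have rA : recursive A.
  rewrite /A /doubling_numerator.
  apply: (@recursive_prim_rec n.+1 (fun w => 2 * S w ^ 2 - B w ^ 2)%N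
    (fun j y w => natdist (2 * y ^ 2) (((2 * S w ^ 2) ^ (2 ^ j)) ^ 2))%N m) => //.
    by recursive_tac.
  have rS2 : recursive (fun v : ctx n.+3 => S v.2.2).
    exact: recursive_weaken (recursive_weaken rS).
  by apply: recursive_natdist; recursive_tac.
exists (fun w => 2 * A w ^ 2)%N, (fun w => D w ^ 2)%N, (fun w => (D w ^ 2).-1)%N.
split.
- by recursive_tac.
- by recursive_tac.
- by recursive_tac.
move=> k v; set w : ctx n.+1 := (k, v).
have S0 : (0 < S w)%N by rewrite muln_gt0 expn_gt0.
have D0 : (0 < D w)%N by rewrite expn_gt0 muln_gt0 expn_gt0 S0.
rewrite prednK; last by rewrite sqrn_gt0.
pose rho : R := ((p (k.+1, v))%:R - (q (k.+1, v))%:R) / (d (k.+1, v)).+1%:R.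
have rhoB : `|rho| <= (B w)%:R.
  rewrite natr_natdist normrM normfV [`|_.+1%:R|]ger0_norm // ler_pdivrMr ?ltr0n //.
  by rewrite ler_peMr // ler1n.
pose h := rho / 2 ^+ (m w).+1.
have BM : (B w)%:R <= 2 ^+ (m w).+1 :> R.
  rewrite -natrX ler_nat (leq_trans (ltnW (ltn_expl (B w) (ltnSn 1)))) //.
  by rewrite leq_exp2l // /m; lia.
have h1 : `|h| <= 1.
  rewrite /h normrM normfV [`|2 ^+ _|]ger0_norm ?exprn_ge0 //.
  by rewrite ler_pdivrMr ?exprn_gt0 // mul1r (le_trans rhoB).
have BS : (B w <= S w)%N.
  rewrite /S; have := BM; rewrite -natrX ler_nat => /leq_trans; apply.
  by rewrite leq_pmull.
have SR : (S w)%:R != 0 :> R by rewrite pnatr_eq0 -lt0n.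
have hE : h ^+ 2 = (B w)%:R ^+ 2 / (S w)%:R ^+ 2.
  rewrite /h /rho -(real_normK (num_real (_ / _ / _))) -mulrA -invfM.
  rewrite normrM -natr_natdist -/(B w) normfV -natrX -natrM -/(S w).
  by rewrite [`|(S w)%:R|]ger0_norm // expr_div_n.
have h2 : 1 - h ^+ 2 / 2 = (2 * S w ^ 2 - B w ^ 2)%:R / (2 * S w ^ 2)%:R.
  rewrite hE natrB; last first.
    by rewrite (@leq_trans (S w ^ 2)) ?leq_sqr ?leq_pmull.
  by rewrite natrM !natrX; move: (S w)%:R (B w)%:R SR => x y x0; field.
have := cos_doubling_numerator (m w) _ h2; rewrite muln_gt0 expn_gt0 S0.
rewrite -/(A w) -/(D w) => /(_ isT) cE.
have DR : (D w)%:R != 0 :> R by rewrite pnatr_eq0 -lt0n.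
have -> : ((2 * A w ^ 2)%:R - (D w ^ 2)%:R) / (D w ^ 2)%:R =
    cos_doubling h (m w).+1.
  rewrite /= -(real_normK (num_real (cos_doubling h (m w)))) cE.
  rewrite natrM (natrX _ (A w) 2) (natrX _ (D w) 2).
  by move: (A w)%:R (D w)%:R DR => x y y0; field.
have hM : 2 ^+ (m w).+1 * h = rho by rewrite /h mulrC divfK ?expf_neq0.
have [_] := cos_doubling_approx (m w).+1 h1; rewrite hM => ce.
have {}ce : `|cos_doubling h (m w).+1 - cos rho| <= 2 ^- k.+1.
  apply: (le_trans ce); rewrite /h normrM normfV [`|2 ^+ _|]ger0_norm ?exprn_ge0 //.
  rewrite expr_div_n (_ : 4 ^+ _ = (2 ^+ (m w).+1) ^+ 2); last first.
    by rewrite exprAC; congr (_ ^+ _); rewrite -natrX.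
  set M := 2 ^+ (m w).+1; have M0 : 0 < M by rewrite exprn_gt0.
  rewrite (_ : _ * _ = `|rho| ^+ 3 / M); last by field; rewrite gt_eqF.
  have rho3 : `|rho| ^+ 3 <= 2 ^+ (3 * B w).
    rewrite mulnC exprM; apply: lerXn2r; rewrite ?nnegrE ?exprn_ge0 //.
    by rewrite (le_trans rhoB) // natr_le_exp2.
  rewrite ler_pdivrMr // (le_trans rho3) // /M /m addSn -addnS -addSn exprD.
  by rewrite mulrA mulVf ?expf_neq0 // mul1r ler_weXn2l ?ler1n.
rewrite -(subrKA (cos rho)) (le_trans (ler_normD _ _)) // (splitr (2 ^- k)).
have -> : 2 ^- k / 2 = 2 ^- k.+1 :> R by rewrite exprSr invfM.
by rewrite lerD // ?(distrC (cos rho)) // (le_trans (cos_lipschitz _ _)) // uE.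
Qed.

(** With a prescribed denominator [2 ^ k] the coefficients of a sum can be
    replaced by integers in a condition that is homogeneous in them. *)
Lemma computable_real_fixed_point (u : ctx n -> R) : computable_real u ->
  exists p q : ctx n.+1 -> nat, [/\ recursive p, recursive q
    & forall k v, `|u v - ((p (k, v))%:R - (q (k, v))%:R) / 2 ^+ k|
        <= 2 * 2 ^- k].
Proof.
case=> p [q [d [rp rq rd uE]]].
exists (fun w => (p w * 2 ^ w.1) %/ (d w).+1)%N,
  (fun w => (q w * 2 ^ w.1) %/ (d w).+1)%N.
split.
- by recursive_tac.
- by recursive_tac.
move=> k v /=.
have fl (a b : nat) : exists2 t : R, 0 <= t <= 2 ^- k
    & ((a * 2 ^ k) %/ b.+1)%N%:R / 2 ^+ k = a%:R / b.+1%:R - t.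
  exists (((a * 2 ^ k) %% b.+1)%N%:R / b.+1%:R / 2 ^+ k).
    rewrite !divr_ge0 ?exprn_ge0 //= ler_pdivrMr ?exprn_gt0 // mulVf ?expf_neq0 //.
    by rewrite ler_pdivrMr ?ltr0n // mul1r ler_nat ltnW // ltn_mod.
  have b0 : b.+1%:R != 0 :> R by rewrite pnatr_eq0.
  have e0 : 2 ^+ k != 0 :> R by rewrite expf_neq0.
  have := congr1 (fun i : nat => i%:R : R) (divn_eq (a * 2 ^ k) b.+1).
  rewrite natrD !natrM natrX; move: (_ %/ _)%:R (_ %% _)%:R => y z yz.
  have -> : a%:R = (y * b.+1%:R + z) / 2 ^+ k by rewrite -yz mulfK.
  move: (b.+1%:R : R) (2 ^+ k : R) b0 e0 => c e c0 e0.
  by field; rewrite ?c0 ?e0.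
have [t /andP[t0 t1] ->] : exists2 t : R, - 2 ^- k <= t <= 2 ^- k &
   ((p (k, v) * 2 ^ k %/ (d (k, v)).+1)%N%:R -
    (q (k, v) * 2 ^ k %/ (d (k, v)).+1)%N%:R) / 2 ^+ k =
   ((p (k, v))%:R - (q (k, v))%:R) / (d (k, v)).+1%:R + t.
  have [t t1 tE] := fl (p (k, v)) (d (k, v)).
  have [s s1 sE] := fl (q (k, v)) (d (k, v)).
  exists (s - t); first by lra.
  by rewrite mulrBl tE sE; ring.
have := uE k v; rewrite opprD addrA.
move: (u v - _) (2 ^- k) t0 t1 => x a t0 t1 xa.
by rewrite (le_trans (ler_normB _ _)) // mulr_natl mulr2n lerD // ler_norml t0.
Qed.

End ComputableReal.

(** * Large deviations of Rademacher sums *)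

Section LargeDeviations.
Variable R : realType.

(** The optimal exponent is [x ^ 2 / 2]; a larger constant allows a proof from
    the inequality [1 + x <= expR x] alone, since only the order of magnitude
    matters for the deviation bound. *)
Lemma expR_cosh_le (x : R) : expR x + expR (- x) <= 2 * expR (2 * x ^+ 2).
Proof.
wlog x0 : x / 0 <= x => [wl|].
  case/orP: (le_total 0 x) => [/wl //|x0].
  by have := wl (- x); rewrite oppr_ge0 opprK sqrrN addrC; apply.
case: (leP x (1 / 2)) => [x1|x1].
  have e1 : expR x <= 1 + x + 2 * x ^+ 2.
    have := expR_ge1Dx (- x); rewrite expRN => e.
    rewrite -[expR x]invrK (le_trans (_ : _ <= (1 - x)^-1)) //.
      by rewrite lef_pV2 // posrE ?invr_gt0 ?expR_gt0 //; lra.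
    rewrite -[leLHS]mul1r ler_pdivrMr; last by lra.
    have : 0 <= x ^+ 2 * (1 - 2 * x) by rewrite mulr_ge0 ?sqr_ge0 //; lra.
    by nra.
  have e2 : expR (- x) <= 1 - x + x ^+ 2.
    have := expR_ge1Dx x => e.
    rewrite expRN (le_trans (_ : _ <= (1 + x)^-1)) //.
      by rewrite lef_pV2 // posrE ?expR_gt0 //; lra.
    rewrite -[leLHS]mul1r ler_pdivrMr; last by lra.
    have : 0 <= x ^+ 2 * x by rewrite mulr_ge0 ?sqr_ge0.
    by nra.
  have := expR_ge1Dx (2 * x ^+ 2); have := sqr_ge0 x; lra.
have e1 : expR x <= expR (2 * x ^+ 2) by rewrite ler_expR expr2; nra.
have e2 : expR (- x) <= expR x by rewrite ler_expR; lra.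
by lra.
Qed.

Lemma sum_nat_double (F : nat -> R) m :
  \sum_(0 <= v < m.*2) F v = \sum_(0 <= v < m) (F v.*2 + F v.*2.+1).
Proof.
elim: m => [|m IHm]; first by rewrite !big_nil.
by rewrite doubleS !big_nat_recr //= IHm addrA.
Qed.

(** Independence of the binary digits of a number below [2 ^ N]. *)
Lemma sum_bits_prod (F : nat -> bool -> R) N :
  \sum_(0 <= v < (2 ^ N)%N) \prod_(0 <= n < N) F n (odd (v %/ 2 ^ n)) =
  \prod_(0 <= n < N) (F n false + F n true).
Proof.
elim: N F => [|N IHN] F; first by rewrite big_nat1 !big_nil.
rewrite expnS mul2n sum_nat_double big_nat_recl // -(IHN (fun n => F n.+1)) mulr_sumr.
apply: eq_bigr => v _; rewrite !big_nat_recl // mulrDl !divn1 /= odd_double.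
by congr (_ * _ + _ * _); apply: eq_bigr => n _;
  rewrite expnS divnMA divn2 ?doubleK //= uphalf_double.
Qed.

Definition rademacher_sign (b : bool) : R := if b then 1 else -1.

(** The sample points are the numbers [v < 2 ^ N], whose binary digits are the
    signs. *)
Definition rademacher_sum (r : nat -> R) (N v : nat) : R :=
  \sum_(0 <= n < N) rademacher_sign (odd (v %/ 2 ^ n)) * r n.

Lemma exp_moment (r : nat -> R) (N : nat) :
  \sum_(0 <= v < (2 ^ N)%N) expR (rademacher_sum r N v) <=
  2 ^+ N * expR (2 * \sum_(0 <= n < N) r n ^+ 2).
Proof.
under eq_bigr do rewrite expR_sum.
rewrite (@sum_bits_prod (fun n b => expR (rademacher_sign b * r n))).
rewrite mulr_sumr expR_sum -{2}(subn0 N) -prodr_const_nat -big_split /=.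
apply: ler_prod => n _; rewrite addr_ge0 ?expR_ge0 //=.
by rewrite mul1r mulN1r addrC expR_cosh_le.
Qed.

(** Markov's inequality for the exponentials of [s] and [- s] times the sum,
    with the optimal [s]. Stating the bound with squares makes it homogeneous in the
    coefficients, and avoids square roots in the test derived from it. *)
Lemma rademacher_deviation (r : nat -> R) (N : nat) (a : R) : 0 < a ->
  (rank (fun v => a * \sum_(0 <= n < N) r n ^+ 2 < rademacher_sum r N v ^+ 2)
     (2 ^ N))%:R <= 2 ^+ N * (2 * expR (- (a / 8))).
Proof.
move=> a0; set Q := \sum_(0 <= n < N) r n ^+ 2.
have Q0 : 0 <= Q by apply: sumr_ge0 => n _; exact: sqr_ge0.
have [Qz|Qn0] := eqVneq Q 0.
  have r0 n : (n < N)%N -> r n = 0.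
    move=> nN; apply/eqP; rewrite -sqrf_eq0.
    have /eqP := Qz; rewrite /Q big_mkord psumr_eq0; last first.
      by move=> i _; exact: sqr_ge0.
    by move=> /allP/(_ (Ordinal nN) (mem_index_enum _)).
  rewrite /rank big1 ?mulr_ge0 ?expR_ge0 ?exprn_ge0 // => v _.
  rewrite /rademacher_sum big_nat_cond big1 => [|n].
    by rewrite Qz mulr0 expr0n ltxx.
  by rewrite andbT => /andP[_ /r0 ->]; rewrite mulr0.
have {Q0 Qn0} Q0 : 0 < Q by rewrite lt_def Qn0.
pose s := Num.sqrt (a / Q) / 4.
have s2 : s ^+ 2 * Q = a / 16.
  rewrite /s expr_div_n sqr_sqrtr ?divr_ge0 ?ltW //.
  by field; rewrite gt_eqF.
clearbody s.
have sumZ t : (fun v => t * rademacher_sum r N v) =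
    rademacher_sum (fun n => t * r n) N.
  apply/funext => v; rewrite /rademacher_sum mulr_sumr.
  by apply: eq_bigr => n _; rewrite mulrCA.
have moment t : t ^+ 2 = s ^+ 2 ->
    \sum_(0 <= v < (2 ^ N)%N) expR (t * rademacher_sum r N v) <=
      2 ^+ N * expR (a / 8).
  move=> ts; have := exp_moment (fun n => t * r n) N.
  rewrite -sumZ => /le_trans; apply.
  rewrite (eq_bigr (fun n => t ^+ 2 * r n ^+ 2)) => [|n _]; last by rewrite exprMn.
  rewrite -mulr_sumr ts s2 (_ : 2 * (a / 16) = a / 8) //; lra.
have mk v : (nat_of_bool (a * Q < rademacher_sum r N v ^+ 2)%R)%:R <=
    expR (- (a / 4)) *
    (expR (s * rademacher_sum r N v) + expR (- s * rademacher_sum r N v)).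
  case: ltP => [aY|_]; last by rewrite mulr_ge0 ?addr_ge0 ?expR_ge0.
  rewrite [leLHS](_ : _ = expR (- (a / 4)) * expR (a / 4)); last first.
    by rewrite mulrC expRxMexpNx_1.
  rewrite ler_wpM2l ?expR_ge0 // mulNr.
  set y := s * _.
  have : (a / 4) ^+ 2 <= y ^+ 2.
    rewrite /y [leRHS]exprMn (le_trans (_ : _ <= s ^+ 2 * (a * Q))) //.
      have -> : s ^+ 2 * (a * Q) = a * (s ^+ 2 * Q) by ring.
      by rewrite s2; lra.
    by rewrite ler_wpM2l ?sqr_ge0 // ltW.
  rewrite -(real_normK (num_real y)) ler_sqr ?nnegrE ?normr_ge0 //; last by lra.
  move=> ay; have : expR (a / 4) <= expR `|y| by rewrite ler_expR.
  by case: (ler0P y) => _ /le_trans; apply; rewrite ?lerDl ?lerDr expR_ge0.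
rewrite /rank natr_sum (le_trans (ler_sum _ (fun v _ => mk v))) //.
rewrite -mulr_sumr big_split /=.
have := lerD (moment s erefl) (moment (- s) (sqrrN s)).
have -> : - (a / 4) = - (a / 8) - (a / 8) by lra.
rewrite expRD => mm; rewrite -mulrA.
rewrite (le_trans (ler_wpM2l (expR_ge0 _) (ler_wpM2l (expR_ge0 _) mm))) //.
have := expRxMexpNx_1 (a / 8).
move: (expR (a / 8)) (expR (- (a / 8))) (2 ^+ N) => x y z xy.
have -> : y * (y * (z * x + z * x)) = (x * y) * (z * (2 * y)) by ring.
by rewrite xy mul1r.
Qed.

Lemma rank_has (I : Type) (P : I -> pred nat) (s : seq I) (m : nat) :
  (rank (fun v => has (fun i => P i v) s) m <= \sum_(i <- s) rank (P i) m)%N.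
Proof.
rewrite /rank exchange_big /=; apply: leq_sum => v _.
elim: s => [|i s IHs] /=; first by rewrite big_nil.
by rewrite big_cons (leq_trans _ (leq_add (leqnn _) IHs)) //; case: (P i v); case: has.
Qed.

End LargeDeviations.

(** * The exceptional sign patterns of a block *)

Lemma recursive_odd n (a : ctx n -> nat) : recursive a ->
  recursive (fun v => odd (a v)).
Proof.
move=> ra.
apply: (@eq_recursive _ (fun v => a v %% 2)%N); last by recursive_tac.
by move=> v; rewrite modn2.
Qed.

Lemma recursive_sum_from n (F : nat -> ctx n -> nat) (a b : ctx n -> nat) :
  recursive (fun v : ctx n.+1 => F v.1 v.2) -> recursive a -> recursive b ->
  recursive (fun v => \sum_(a v <= i < b v) F i v)%N.
Proof.
move=> rF ra rb.
apply: (@eq_recursive _ (fun v => \sum_(0 <= i < b v) (a v <= i) * F i v)%N).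
  move=> v; rewrite [RHS](big_nat_widenl _ 0%N) // [RHS]big_mkcond /=.
  by apply: eq_bigr => i _; case: leqP; rewrite ?mul1n ?mul0n.
have ra' := recursive_weaken ra; by recursive_tac.
Qed.

(** The integer coefficients are differences [p n - q n] of natural numbers, so
    that changing the sign of a term amounts to exchanging [p n] and [q n]. *)
Definition deviates (a l m : nat) (p q : nat -> nat) (v : nat) : bool :=
  (a * \sum_(l <= n < m) natdist (p n) (q n) ^ 2 <
   natdist (\sum_(l <= n < m) (if odd (v %/ 2 ^ n) then p n else q n))
           (\sum_(l <= n < m) (if odd (v %/ 2 ^ n) then q n else p n)) ^ 2)%N.

Lemma recursive_deviates n (a l m x : ctx n -> nat) (p q : nat -> ctx n -> nat) :
  recursive a -> recursive l -> recursive m -> recursive x ->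
  recursive (fun w : ctx n.+1 => p w.1 w.2) ->
  recursive (fun w : ctx n.+1 => q w.1 w.2) ->
  recursive (fun v => deviates (a v) (l v) (m v)
    (fun j => p j v) (fun j => q j v) (x v)).
Proof.
move=> ra rl rm rx rp rq; rewrite /deviates.
have rbit : recursive (fun v : ctx n.+1 => odd (x v.2 %/ 2 ^ v.1)).
  apply: recursive_odd; have rx' := recursive_weaken rx; by recursive_tac.
apply: recursive_leq; [apply: recursive_succ; apply: recursive_mul => //|
  apply: recursive_exp; [apply: recursive_natdist|exact: recursive_const]];
  apply: (@recursive_sum_from n (fun i v => _)) => //.
- by apply: recursive_exp; [exact: recursive_natdist|exact: recursive_const].
- exact: recursive_if.
- exact: recursive_if.
Qed.

Section Count.
Variable R : realType.

Lemma sum_nat_subrange (F : nat -> R) (l m N : nat) : (m <= N)%N ->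
  \sum_(l <= n < m) F n = \sum_(0 <= n < N) (if (l <= n < m)%N then F n else 0).
Proof.
move=> mN; rewrite (big_nat_widenl _ 0%N) // (big_nat_widen _ _ _ _ _ mN).
by rewrite [LHS]big_mkcond; apply: eq_bigr => n _; rewrite andTb.
Qed.

Lemma deviatesE (a l m : nat) (p q : nat -> nat) (v : nat) :
  deviates a l m p q v =
    (a%:R * \sum_(l <= n < m) ((p n)%:R - (q n)%:R) ^+ 2 <
     (\sum_(l <= n < m)
        rademacher_sign R (odd (v %/ 2 ^ n)) * ((p n)%:R - (q n)%:R)) ^+ 2).
Proof.
rewrite /deviates -(ltr_nat R) natrM !natr_sum natrX natr_natdist.
rewrite (real_normK (num_real _)) !natr_sum -sumrB; congr (_ * _ < _ ^+ 2).
  by apply: eq_bigr => n _; rewrite natrX natr_natdist (real_normK (num_real _)).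
by apply: eq_bigr => n _; rewrite /rademacher_sign; case: odd;
  rewrite ?mul1r // mulN1r opprB.
Qed.

Lemma rank_deviates (a l m N : nat) (p q : nat -> nat) : (m <= N)%N -> (0 < a)%N ->
  (rank (deviates a l m p q) (2 ^ N))%:R <=
    2 ^+ N * (2 * expR (- (a%:R / 8))) :> R.
Proof.
move=> mN a0.
pose r n : R := if (l <= n < m)%N then (p n)%:R - (q n)%:R else 0.
rewrite (le_trans _ (rademacher_deviation r N _)) ?ltr0n // ler_nat.
apply/eq_leq; apply: eq_bigr => v _; congr nat_of_bool; rewrite deviatesE.
rewrite !(sum_nat_subrange _ _ mN) /rademacher_sum; congr (_ * _ < _ ^+ 2);
  by apply: eq_bigr => n _; rewrite /r; case: ifP => _ //; rewrite ?expr0n ?mulr0.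
Qed.

End Count.

Definition block_start (k : nat) : nat := 2 ^ (2 ^ k).
(** The angles of the grid are the multiples of [(grid_size k)^-1] up to 8, a
    bound for [2 * pi]. The mesh is [N ^ - 3], where [N = block_start k.+1],
    because moving the angle by it changes a partial sum of the block by at most
    a constant times [N ^ - 1]. *)
Definition grid_size (k : nat) : nat := block_start k.+1 ^ 3.

(** [m] ranges over the ends of the partial sums and [i] over the angles of the
    grid; [p k i n - q k i n] stands for the coefficient of index [n] at the
    angle [i / grid_size k]. *)
Definition block_test (p q : nat -> nat -> nat -> nat) (k v : nat) : bool :=
  has (fun m => has (fun i =>
      deviates (128 * 2 ^ k) (block_start k) m
        (fun n => p k i n) (fun n => q k i n) v)
    (index_iota 0 (8 * grid_size k).+1)) (index_iota 0 (block_start k.+1).+1).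

Lemma recursive_block_test p q : recursive3 p -> recursive3 q ->
  recursive2 (block_test p q).
Proof.
move=> rp rq; rewrite /recursive2 /block_test /grid_size /block_start.
recursive_tac.
(* the arguments are, in this order, [i], [m], [k] and [v] *)
apply: (@recursive_deviates 4 (fun w => 128 * 2 ^ w.2.2.1)%N
  (fun w => 2 ^ (2 ^ w.2.2.1))%N (fun w => w.2.1)
  (fun w => w.2.2.2.1) (fun j w => p w.2.2.1 w.1 j)
  (fun j w => q w.2.2.1 w.1 j)); by recursive_tac.
Qed.

(** At most [(N + 1) * (8 * N ^ 3 + 1)] deviations occur in the test, and the
    choice of the constant 128 makes each of them satisfied by a proportion at
    most [2 * N ^ - 8] of the patterns. The product is at most [N ^ - 1], which
    is smaller than [2 ^ - (2 * k)]. *)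
Lemma rank_block_test (R : realType) p q k :
  (rank (block_test p q k) (2 ^ block_start k.+1) * 2 ^ k.*2 <=
    2 ^ block_start k.+1)%N.
Proof.
set N := block_start k.+1; set r := rank _ _.
have N4 : (4 <= N)%N.
  rewrite /N /block_start -{1}(expn1 2) -[4%N]/(2 ^ 2)%N leq_exp2l // expnS.
  by rewrite leq_pmulr ?expn_gt0.
have : r%:R <= ((N.+1 * (8 * N ^ 3).+1)%N)%:R *
    (2 ^+ N * (2 * expR (- ((128 * 2 ^ k)%N%:R / 8)))) :> R.
  apply: (@le_trans _ _ (\sum_(0 <= m < N.+1) \sum_(0 <= i < (8 * N ^ 3).+1)
     rank (deviates (128 * 2 ^ k) (block_start k) m
       (fun n => p k i n) (fun n => q k i n)) (2 ^ N))%N%:R).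
    rewrite ler_nat (leq_trans (rank_has _ _ _)) //; apply: leq_sum => m _.
    exact: rank_has.
  rewrite natr_sum big_nat.
  rewrite (le_trans (ler_sum _ (_ : forall m, (0 <= m < N.+1)%N -> _ <=
     (8 * N ^ 3).+1%:R * (2 ^+ N * (2 * expR (- ((128 * 2 ^ k)%N%:R / 8))))))) //.
    move=> m /andP[_ mN]; rewrite natr_sum.
    rewrite (le_trans (ler_sum _ (_ : forall i, true -> _ <=
      2 ^+ N * (2 * expR (- ((128 * 2 ^ k)%N%:R / 8)))))) //.
      by move=> i _; apply: rank_deviates => //; rewrite muln_gt0 expn_gt0.
    by rewrite sumr_const_nat subn0 -[leLHS]mulr_natl.
  rewrite -big_nat sumr_const_nat subn0 -[leLHS]mulr_natl.
  by rewrite (natrM R N.+1) -[leRHS]mulrA.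
have N0 : (0 < N)%N by exact: leq_trans N4.
have -> : (128 * 2 ^ k)%N%:R / 8 = (16 * 2 ^ k)%N%:R :> R.
  by rewrite !natrM; move: (2 ^ k)%N%:R => y; field.
have eN : expR (- (16 * 2 ^ k)%N%:R) <= (N ^ 8)%N%:R^-1 :> R.
  rewrite expRN lef_pV2 ?posrE ?expR_gt0 ?ltr0n ?expn_gt0 ?N0 //.
  have -> : (N ^ 8 = 2 ^ (16 * 2 ^ k))%N.
    by rewrite /N /block_start -expnM expnS; congr (2 ^ _)%N; lia.
  rewrite -[X in expR X]mulr1 expRM_natl natrX lerXn2r ?nnegrE ?expR_ge0 //.
  (* [2 <= expR 1] *)
  by have := expR_ge1Dx (1 : R).
move=> rE.
have {rE eN} : (r * N ^ 8 <= (N.+1 * (8 * N ^ 3).+1) * (2 ^ N * 2))%N.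
  rewrite -(ler_nat R) natrM -ler_pdivlMr ?ltr0n ?expn_gt0 ?N0 //.
  apply: (le_trans rE); rewrite (natrM R (N.+1 * _)) (natrM R (2 ^ N)) natrX.
  by rewrite -[leRHS]mulrA -[(_ * 2) / _]mulrA !ler_wpM2l ?exprn_ge0.
have small : (N.+1 * (8 * N ^ 3).+1 * 2 <= N ^ 7)%N.
  apply: (@leq_trans ((2 * N) * (16 * N ^ 3) * 2)).
    rewrite leq_mul2r leq_mul //; last by have := expn_gt0 N 3; rewrite N0; lia.
    by lia.
  rewrite (_ : _ * _ * 2 = 64 * N ^ 4)%N; last by rewrite (expnS N 3); lia.
  by rewrite (expnD N 3 4) leq_mul2r (@leq_exp2r 4 N 3) ?N4 ?orbT.
move=> rN; have {rN small} rN : (r * N <= 2 ^ N)%N.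
  rewrite -(@leq_pmul2r (N ^ 7)) ?expn_gt0 ?N0 // -mulnA -expnS (leq_trans rN) //.
  by rewrite mulnCA leq_mul2l small orbT.
apply: leq_trans rN; rewrite leq_mul2l /N /block_start leq_exp2l //.
by rewrite expnS mul2n leq_double ltnW ?orbT // ltn_expl.
Qed.

(** * Uniform convergence of a series cut into blocks *)

Section UniformConvergence.
Variable R : realType.

Lemma uniform_cauchy_continuous_limit (S : nat -> R -> R) (a b : R) :
  (forall n, continuous (S n)) ->
  (forall e, 0 < e -> exists n0, forall n t, (n0 <= n)%N -> t \in `[a, b] ->
    `|S n t - S n0 t| <= e) ->
  exists2 f : R -> R, {within `[a, b], continuous f}
    & forall t, t \in `[a, b] -> (fun n => S n t) @ \oo --> f t.
Proof.
move=> Sc Su; pose f t := lim ((fun n => S n t) @ \oo).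
have Sf t : t \in `[a, b] -> (fun n => S n t) @ \oo --> f t.
  move=> tab; apply: cauchy_cvg; apply: cauchy_exP => e e0.
  have [n0 Sn0] := Su (e / 2) (divr_gt0 e0 (ltr0n _ 2)).
  exists (S n0 t); exists n0 => // n /= n0n.
  rewrite /ball /= distrC (le_lt_trans (Sn0 n t n0n tab)) //.
  by rewrite ltr_pdivrMr // ltr_pMr // ltr1n.
exists f => //.
apply: (@uniform_limit_continuous_subspace _ _ _ (S @ \oo)).
  by near_simpl; apply: nearW => n; apply: continuous_subspaceT; exact: Sc.
move=> P /uniform_nbhs [E [entE EP]].
move: entE; rewrite -entourage_ballE => -[e /= e0 eE].
have [n0 Sn0] := Su (e / 4) (divr_gt0 e0 (ltr0n _ 4)).
exists n0 => // n /= n0n; apply: EP => t /= tab; apply: eE => /=.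
have /cvgrPdist_le /(_ _ (divr_gt0 e0 (ltr0n _ 4))) [m _ Sm] := Sf t tab.
have := Sm (maxn m n0) (leq_maxl _ _).
have := Sn0 (maxn m n0) t (leq_maxr _ _) tab.
have := Sn0 n t n0n tab.
rewrite /ball /=; move: (f t) (S n t) (S _ t) (S _ t) => u v w x.
rewrite !ler_norml ltr_norml; lra.
Qed.

(** Bounds on all partial sums inside each block, and not only on the sums over
    complete blocks, are what controls an arbitrary partial sum. *)
Lemma telescope_blocks (F : nat -> R) (N : nat -> nat) (B : nat -> R) (k l M : nat) :
  {homo N : i j / (i <= j)%N} ->
  (forall j m, (k <= j)%N -> (N j <= m <= N j.+1)%N ->
    `|\sum_(N j <= n < m) F n| <= B j) ->
  (forall j, 0 <= B j) ->
  (N k <= M <= N (k + l))%N ->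
  `|\sum_(N k <= n < M) F n| <= \sum_(k <= j < k + l) B j.
Proof.
move=> Nh FB B0; elim: l M => [|l IHl] M.
  rewrite addn0 => /andP[kM Mk]; rewrite big_geq // normr0; exact: sumr_ge0.
rewrite addnS => /andP[kM Ml]; rewrite big_nat_recr ?leq_addr //=.
case: (leqP M (N (k + l))) => Mk.
  by rewrite (le_trans (IHl M _)) ?kM ?Mk // lerDl.
have kN : (N k <= N (k + l))%N by apply: Nh; exact: leq_addr.
rewrite (big_cat_nat kN (ltnW Mk)) /=.
rewrite (le_trans (ler_normD _ _)) // lerD //.
  by apply: IHl; rewrite kN leqnn.
by apply: FB; rewrite ?leq_addr // Ml (ltnW Mk).
Qed.

Lemma small_tails (B : nat -> R) (c : R) : (forall j, 0 <= B j) ->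
  (forall l, \sum_(0 <= j < l) B j <= c) ->
  forall e, 0 < e -> exists k, forall l, (k <= l)%N -> \sum_(k <= j < l) B j <= e.
Proof.
move=> B0 Bc e e0; pose A := range (fun l => \sum_(0 <= j < l) B j).
have supA : has_sup A.
  split; first by exists (\sum_(0 <= j < 0) B j), 0%N.
  by exists c => _ [l _ <-].
have [_ [k _ <-] ke] := sup_adherent e0 supA.
exists k => l kl; have : \sum_(0 <= j < l) B j <= sup A.
  by apply: (ub_le_sup supA.2); exists l.
rewrite (big_cat_nat (n := k)) //=; move: ke; lra.
Qed.

(** Cauchy condensation: [2 ^ k.+1 * s (2 ^ k.+1)] is at most twice the sum of
    [s j] over [2 ^ k <= j < 2 ^ k.+1]. *)
Lemma condensation (s : nat -> R) (c : R) :
  nonincreasing_seq s -> (forall j, 0 <= s j) ->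
  (forall l, \sum_(1 <= j < l) s j <= c) ->
  forall l, \sum_(0 <= k < l) 2 ^+ k * s (2 ^ k)%N <= s 1%N + 2 * c.
Proof.
move=> sd s0 sc.
have c0 : 0 <= c by rewrite (le_trans _ (sc 0%N)) // big_geq.
have main l : \sum_(0 <= k < l.+1) 2 ^+ k * s (2 ^ k)%N <=
    s 1%N + 2 * \sum_(1 <= j < 2 ^ l) s j.
  elim: l => [|l IHl].
    by rewrite big_nat1 expr0 mul1r expn0 big_geq // mulr0 addr0.
  rewrite big_nat_recr //= [in leRHS](big_cat_nat (n := (2 ^ l)%N));
    rewrite ?expn_gt0 ?leq_exp2l //.
  rewrite mulrDr addrA lerD // exprS -mulrA ler_wpM2l //.
  rewrite (le_trans (_ : _ <= \sum_(2 ^ l <= j < 2 ^ l.+1) s (2 ^ l.+1)%N)) //.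
    by rewrite sumr_const_nat expnS mul2n -addnn addnK -natrX mulr_natl.
  rewrite [leLHS]big_nat [leRHS]big_nat; apply: ler_sum => j /andP[_ jl].
  by apply: sd; exact: ltnW.
case=> [|l]; first by rewrite big_geq // addr_ge0 ?mulr_ge0.
by rewrite (le_trans (main l)) // lerD2l ler_pM2l.
Qed.

End UniformConvergence.

(** * The blocks of the random series *)

Lemma exp2_le_block_end k : (2 ^ k <= block_start k.+1)%N.
Proof.
rewrite /block_start leq_exp2l // (leq_trans (ltnW (ltn_expl k (ltnSn 1)))) //.
by rewrite leq_exp2l.
Qed.

Lemma sum_le_const (R : realType) (F : nat -> R) (l m N : nat) (c : R) :
  0 <= c -> (m <= N)%N -> (forall n, (l <= n < m)%N -> F n <= c) ->
  \sum_(l <= n < m) F n <= N%:R * c.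
Proof.
move=> c0 mN Fc; rewrite (le_trans (_ : _ <= \sum_(l <= n < m) c)) //.
  by rewrite [leLHS]big_nat [leRHS]big_nat; exact: ler_sum.
rewrite sumr_const_nat -[leLHS]mulr_natl ler_wpM2r // ler_nat.
by rewrite (leq_trans (leq_subr _ _)).
Qed.

Section Blocks.
Variables (R : realType) (x phi : nat -> R).
Local Notation s := (dyadic_norm x).

Lemma dyadic_norm_ge0 j : 0 <= s j.
Proof. exact: sqrtr_ge0. Qed.

Lemma dyadic_norm_sqr j : s j ^+ 2 = \sum_(2 ^ j <= n < 2 ^ j.+1) x n ^+ 2.
Proof. by rewrite sqr_sqrtr // sumr_ge0 // => n _; exact: sqr_ge0. Qed.

Lemma sum_sqr_dyadic i l :
  \sum_(2 ^ i <= n < 2 ^ (i + l)) x n ^+ 2 = \sum_(i <= j < i + l) s j ^+ 2.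
Proof.
elim: l => [|l IHl]; first by rewrite addn0 !big_geq.
have le1 : (2 ^ i <= 2 ^ (i + l))%N by rewrite leq_exp2l // leq_addr.
have le2 : (2 ^ (i + l) <= 2 ^ (i + l).+1)%N by rewrite leq_exp2l.
rewrite addnS (big_cat_nat le1 le2) /= IHl big_nat_recr ?leq_addr //=.
by rewrite dyadic_norm_sqr.
Qed.

Hypothesis s_decr : nonincreasing_seq s.

(** The block is a union of [2 ^ k] dyadic ranges, on each of which the norm is
    at most [s (2 ^ k)]. *)
Lemma sum_sqr_block k :
  \sum_(block_start k <= n < block_start k.+1) x n ^+ 2 <=
    2 ^+ k * s (2 ^ k)%N ^+ 2.
Proof.
rewrite /block_start (_ : 2 ^ k.+1 = 2 ^ k + 2 ^ k)%N; last first.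
  by rewrite expnS mul2n addnn.
rewrite sum_sqr_dyadic.
rewrite (le_trans (_ : _ <= \sum_(2 ^ k <= j < 2 ^ k + 2 ^ k) s (2 ^ k)%N ^+ 2)) //.
  rewrite [leLHS]big_nat [leRHS]big_nat; apply: ler_sum => j /andP[kj _].
  by rewrite ler_sqr ?nnegrE ?dyadic_norm_ge0 //; exact: s_decr.
by rewrite sumr_const_nat addnK -natrX mulr_natl.
Qed.

Lemma coef_le n : (0 < n)%N -> `|x n| <= s 0%N.
Proof.
move=> n0; pose j := trunc_log 2 n.
have jn : (2 ^ j <= n < 2 ^ j.+1)%N by rewrite trunc_logP // trunc_log_ltn.
have sj : s j <= s 0%N by exact: s_decr.
rewrite (le_trans _ sj) // -ler_sqr ?nnegrE ?dyadic_norm_ge0 //.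
rewrite (real_normK (num_real _)) dyadic_norm_sqr.
have /andP[jn1 jn2] := jn.
rewrite (big_cat_nat jn1 (ltnW jn2)) /= [X in _ <= _ + X]big_ltn //.
rewrite addrCA lerDl addr_ge0 // sumr_ge0 // => i _; exact: sqr_ge0.
Qed.

(* From here on a block [k] is fixed on which the signs [alpha] pass the test,
   for integers that approximate the coefficients on the scale [N ^ 2]. *)
Variables (p q : nat -> nat -> nat -> nat) (alpha : nat -> bool) (k : nat).
Let N := block_start k.+1.
Let w : R := 2 ^+ k.
Let W : R := N%:R^-1.
Let sg n : R := rademacher_sign R (alpha n).
Let approx i n : R := ((p k i n)%:R - (q k i n)%:R) * W ^+ 2.
Let point i : R := i%:R / (grid_size k)%:R.
Hypothesis approxP : forall i n,
  `|x n * cos (n%:R * point i + phi n) - approx i n| <= 2 * W ^+ 2.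
Hypothesis passed :
  ~~ block_test p q k (bits_value (initial_segment alpha N)).

Let N_gt0 : (0 < N)%N. Proof. by rewrite expn_gt0. Qed.
Let W_gt0 : 0 < W. Proof. by rewrite invr_gt0 ltr0n N_gt0. Qed.
Let NW : N%:R * W = 1. Proof. by rewrite mulfV // pnatr_eq0 -lt0n N_gt0. Qed.

(** Passing the test bounds the square of the sum by [128 * 2 ^ k] times the sum
    of the squared approximations. The latter is compared with the sum of the
    [x n ^ 2] at the cost of an error of order [N ^ - 3], and the factor [2 ^ k]
    is at most [N]. *)
Lemma approx_sum_le i m : (block_start k <= m <= N)%N -> (i <= 8 * grid_size k)%N ->
  `|\sum_(block_start k <= n < m) sg n * approx i n| <=
    16 * (w * s (2 ^ k)%N) + 32 * W.
Proof.
move=> /andP[lm mN] iD.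
have W0 := W_gt0; have w0 : 0 < w by rewrite exprn_gt0.
have ws0 : 0 <= w * s (2 ^ k)%N by rewrite mulr_ge0 ?dyadic_norm_ge0 ?ltW.
have nodev : (\sum_(block_start k <= n < m) sg n * approx i n) ^+ 2 <=
    (128 * w) * \sum_(block_start k <= n < m) approx i n ^+ 2.
  move: passed; rewrite /block_test => /hasPn/(_ m).
  rewrite mem_index_iota ltnS mN => /(_ isT)/hasPn/(_ i).
  rewrite mem_index_iota ltnS iD => /(_ isT).
  rewrite (deviatesE R) -leNgt => nd.
  have := ler_wpM2r (exprn_ge0 4 (ltW W0)) nd.
  rewrite [X in X <= _](_ : _ =
    (\sum_(block_start k <= n < m) sg n * approx i n) ^+ 2); last first.
    rewrite (_ : W ^+ 4 = W ^+ 2 ^+ 2); last by rewrite -exprM.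
    rewrite -exprMn mulr_suml big_nat [in RHS]big_nat.
    congr (_ ^+ 2); apply: eq_bigr => n /andP[_ nm].
    rewrite -mulrA -nth_bits_value ?size_mkseq ?(leq_trans nm) //.
    by rewrite nth_mkseq ?(leq_trans nm).
  move=> /le_trans; apply; rewrite -[leLHS]mulrA mulr_suml natrM natrX.
  rewrite le_eqVlt; apply/orP; left; apply/eqP; congr (_ * _).
  by apply: eq_bigr => n _; rewrite /approx exprMn -exprM.
have sumr : \sum_(block_start k <= n < m) approx i n ^+ 2 <=
    2 * (w * s (2 ^ k)%N ^+ 2) + 8 * W ^+ 3.
  rewrite (le_trans (_ : _ <=
    \sum_(block_start k <= n < m) (2 * x n ^+ 2 + 8 * W ^+ 4))) //.
    apply: ler_sum => n _; have := approxP i n.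
    set c := cos _; have c1 : `|c| <= 1 by exact: cos_max.
    move: (approx i n) => a ha.
    have : `|a| <= `|x n| + 2 * W ^+ 2.
      rewrite -(subrK (x n * c) a) (le_trans (ler_normD _ _)) // addrC lerD //.
        by rewrite normrM ler_piMr.
      by rewrite distrC.
    rewrite -(real_normK (num_real a)) -(real_normK (num_real (x n))).
    have := sqr_ge0 (`|x n| - 2 * W ^+ 2).
    rewrite (_ : W ^+ 4 = W ^+ 2 ^+ 2); last by rewrite -exprM.
    have : 0 <= W ^+ 2 by exact: sqr_ge0.
    move: (W ^+ 2) `|x n| `|a| (normr_ge0 a) (normr_ge0 (x n)).
    move=> v y z z0 y0 v0 h1 h2.
    have := lerXn2r 2 z0 (le_trans z0 h2) h2; nra.
  rewrite big_split /= -mulr_sumr lerD // ?ler_pM2l //.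
    apply: le_trans (sum_sqr_block k).
    rewrite [leRHS](big_cat_nat lm mN) /= lerDl sumr_ge0 // => n _; exact: sqr_ge0.
  rewrite (le_trans (sum_le_const (c := 8 * W ^+ 4) _ mN _)) //.
    by rewrite mulr_ge0 ?exprn_ge0 ?ltW.
  by rewrite (exprS W 3) mulrCA (mulrA N%:R) NW mul1r.
have wW : w * W <= 1.
  by rewrite ler_pdivrMr ?ltr0n ?N_gt0 // mul1r /w -natrX ler_nat exp2_le_block_end.
have bound0 : 0 <= 16 * (w * s (2 ^ k)%N) + 32 * W.
  by rewrite addr_ge0 // mulr_ge0 // ltW.
rewrite -ler_sqr ?nnegrE //.
rewrite (real_normK (num_real _)) (le_trans nodev) //.
have w128 : 0 <= 128 * w by rewrite mulr_ge0 // ltW.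
apply: le_trans (ler_wpM2l w128 sumr) _.
have h1 : W ^+ 2 * (w * W) <= W ^+ 2 by rewrite ler_piMr ?sqr_ge0.
have h2 : 0 <= w * s (2 ^ k)%N * W by exact: mulr_ge0 ws0 (ltW W0).
(* [2 * 128 = 16 ^ 2] and [8 * 128 = 32 ^ 2] *)
have gen (a b c : R) : a ^+ 2 * (b * a) <= a ^+ 2 -> 0 <= b * c * a ->
    128 * b * (2 * (b * c ^+ 2) + 8 * a ^+ 3) <= (16 * (b * c) + 32 * a) ^+ 2.
  by lra.
exact: gen.
Qed.

(** An arbitrary angle is moved to a neighbouring angle of the grid, which
    changes each term by at most [`|x n| * n * N ^ - 3], and there the
    coefficients are replaced by their approximations. *)
Lemma block_sum_le m (th : R) : (block_start k <= m <= N)%N -> 0 <= th <= 8 ->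
  `|\sum_(block_start k <= n < m) sg n * x n * cos (n%:R * th + phi n)| <=
    16 * (w * s (2 ^ k)%N) + (34 + s 0%N) * W.
Proof.
move=> lmN /andP[th0 th8]; have /andP[lm mN] := lmN.
have W0 := W_gt0.
have sg1 n : `|sg n| = 1 by rewrite /sg /rademacher_sign; case: alpha; rewrite ?normrN normr1.
have DR : (grid_size k)%:R^-1 = W ^+ 3 by rewrite /grid_size natrX exprVn.
have D0 : (0 < grid_size k)%N by rewrite !expn_gt0.
pose i := Num.truncn (th * (grid_size k)%:R).
have thD : 0 <= th * (grid_size k)%:R by rewrite mulr_ge0.
have /andP[it ti] := truncn_itv thD.
have iD : (i <= 8 * grid_size k)%N.
  by rewrite -(ler_nat R) (le_trans it) // natrM ler_wpM2r.
have thi : `|th - point i| <= W ^+ 3.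
  rewrite -DR /point ger0_norm; last by rewrite subr_ge0 ler_pdivrMr ?ltr0n.
  rewrite lerBlDr -{1}[(grid_size k)%:R^-1]mul1r -mulrDl.
  by rewrite ler_pdivlMr ?ltr0n // addrC natr1 ltW.
pose f (th' : R) n := cos (n%:R * th' + phi n).
pose e2 n := x n * f (point i) n - approx i n.
pose e3 n := x n * (f th n - f (point i) n).
have -> : \sum_(block_start k <= n < m) sg n * x n * cos (n%:R * th + phi n) =
    \sum_(block_start k <= n < m) sg n * approx i n +
    (\sum_(block_start k <= n < m) sg n * e2 n +
     \sum_(block_start k <= n < m) sg n * e3 n).
  by rewrite -!big_split /=; apply: eq_bigr => n _; rewrite /e2 /e3 /f; ring.
rewrite (le_trans (ler_normD _ _)) //.
have b1 := approx_sum_le lmN iD.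
have b2 : `|\sum_(block_start k <= n < m) sg n * e2 n| <= 2 * W.
  rewrite (le_trans (ler_norm_sum _ _ _)) //.
  have c0 : 0 <= 2 * W ^+ 2 by apply: mulr_ge0 => //; exact: sqr_ge0.
  rewrite (le_trans (sum_le_const (c := 2 * W ^+ 2) c0 mN _)) //.
    by move=> n _; rewrite normrM sg1 mul1r; exact: approxP.
  by rewrite expr2 mulrCA (mulrA N%:R) NW mul1r.
have b3 : `|\sum_(block_start k <= n < m) sg n * e3 n| <= s 0%N * W.
  rewrite (le_trans (ler_norm_sum _ _ _)) //.
  have c0 : 0 <= s 0%N * W ^+ 2.
    by apply: mulr_ge0; [exact: dyadic_norm_ge0|exact: sqr_ge0].
  rewrite (le_trans (sum_le_const (c := s 0%N * W ^+ 2) c0 mN _)) //.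
    move=> n /andP[ln nm]; rewrite normrM sg1 mul1r normrM ler_pM //.
      by apply: coef_le; rewrite (leq_trans _ ln) // expn_gt0.
    rewrite (le_trans (cos_lipschitz _ _)) //.
    rewrite opprD addrACA subrr addr0 -mulrBr normrM ger0_norm //.
    rewrite (le_trans (ler_pM _ _ (_ : _ <= N%:R) thi)) // ?ler_nat.
      by rewrite (leq_trans (ltnW nm)).
    by rewrite exprS mulrA NW mul1r.
  by rewrite mulrCA expr2 (mulrA N%:R) NW mul1r.
have := ler_normD (\sum_(block_start k <= n < m) sg n * e2 n)
  (\sum_(block_start k <= n < m) sg n * e3 n).
by move: b1 b2 b3; lra.
Qed.

End Blocks.

(** Fixed-point approximations with [2 ^ k.+2] binary places: their denominator
    [2 ^ (2 ^ k.+2)] is the square of the end of block [k]. *)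
Lemma computable_blocks (R : realType) (x phi : nat -> R) :
  computable_real_seq x -> computable_real_seq phi ->
  exists p q : nat -> nat -> nat -> nat, [/\ recursive3 p, recursive3 q
    & forall k i n, `|x n * cos (n%:R * (i%:R / (grid_size k)%:R) + phi n) -
       ((p k i n)%:R - (q k i n)%:R) * (block_start k.+1)%:R^-1 ^+ 2|
     <= 2 * (block_start k.+1)%:R^-1 ^+ 2].
Proof.
move=> cx cphi.
(* the arguments are, in this order, the block, the angle and the index *)
pose u (v : ctx 3) : R := x v.2.2.1 *
  cos ((v.2.2.1 * v.2.1)%N%:R / (grid_size v.1).-1.+1%:R + phi v.2.2.1).
have : computable_real u.
  apply: computable_real_mul.
    by apply: computable_real_of_seq => //; exact: recursive_v2.
  apply: computable_real_cos; apply: computable_real_add.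
    by apply: computable_real_ratio; rewrite /grid_size /block_start; recursive_tac.
  by apply: computable_real_of_seq => //; exact: recursive_v2.
case/computable_real_fixed_point => p [q [rp rq uE]].
have at3 (f : ctx 4 -> nat) : recursive f ->
    recursive3 (fun k i n => f ((2 ^ k.+2)%N, (k, (i, (n, tt))))).
  move=> rf.
  have := @recursive_subst 3 f (fun v => 2 ^ v.1.+2)%N rf _.
  move=> H; apply: eq_recursive (H _) => [[k [i [n []]]] //|].
  by recursive_tac.
exists (fun k i n => p ((2 ^ k.+2)%N, (k, (i, (n, tt))))),
  (fun k i n => q ((2 ^ k.+2)%N, (k, (i, (n, tt))))).
split; [exact: at3|exact: at3|move=> k i n].
have -> : (block_start k.+1)%:R^-1 ^+ 2 = 2 ^- (2 ^ k.+2) :> R.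
  by rewrite /block_start natrX exprVn -exprM (expnSr 2 k.+1).
have := uE (2 ^ k.+2)%N (k, (i, (n, tt))); rewrite /u /=.
by rewrite prednK ?expn_gt0 // natrM -mulrA.
Qed.

Theorem theorem4p1 (R : realType) (U : machine)
  (HU : optimal_prefix_machine U)
  (eps x phi : nat -> R)
  (Heps : random_rademacher U eps)
  (Hx : computable_real_seq x)
  (Hphi : computable_real_seq phi)
  (Hdecr : nonincreasing_seq (dyadic_norm x))
  (Hsum : (\sum_(1 <= j <oo) (dyadic_norm x j)%:E < +oo)%E) :
  exists2 f : R -> R, {within `[0, 1], continuous f}
    & forall t : R, t \in `[0, 1] ->
        (fun N : nat => \sum_(0 <= n < N)
           eps n * x n * cos (2 * pi * n%:R * t + phi n)) @ \oo --> f t.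
Proof.
have [alpha Kalpha epsE] := Heps.
have [p [q [rp rq pqE]]] := computable_blocks Hx Hphi.
have [k0 passed] : exists k0, forall k, (k0 <= k)%N ->
    ~~ block_test p q k (bits_value (initial_segment alpha (block_start k.+1))).
  apply: (@KC_avoids_test (block_test p q) (fun k => block_start k.+1)
    _ _ _ U) => //.
  - exact: recursive_block_test.
  - by rewrite /recursive1 /block_start; recursive_tac.
  - move=> k; rewrite (leq_trans _ (ltnW (ltn_expl _ (ltnSn 1)))) //.
    by rewrite expnS mul2n leq_double ltnW // ltn_expl.
  - by move=> k; exact: (rank_block_test R).
set s := dyadic_norm x in Hdecr Hsum *.
pose B k := 16 * (2 ^+ k * s (2 ^ k)%N) + (34 + s 0%N) * 2 ^- k.
have s0 j : 0 <= s j by exact: dyadic_norm_ge0.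
have B0 k : 0 <= B k.
  by rewrite addr_ge0 ?mulr_ge0 ?addr_ge0 ?invr_ge0 ?exprn_ge0.
have [c sc] : exists c, forall l, \sum_(1 <= j < l) s j <= c.
  exists (fine (\sum_(1 <= j <oo) (s j)%:E)%E) => l.
  rewrite -lee_fin fineK ?sumEFin; last first.
    rewrite ge0_fin_numE // nneseries_ge0 // => j _ _; exact: s0.
  by rewrite -sumEFin; apply: nneseries_lim_ge => j _ _; rewrite lee_fin.
have Bc l : \sum_(0 <= k < l) B k <= 16 * (s 1%N + 2 * c) + (34 + s 0%N) * 2.
  rewrite big_split /= -!mulr_sumr lerD // ler_wpM2l ?addr_ge0 //.
    exact: condensation.
  suff -> : \sum_(0 <= k < l) 2 ^- k = 2 - 2 * 2 ^- l :> R.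
    by rewrite gerBl mulr_ge0 ?invr_ge0 ?exprn_ge0.
  elim: l => [|l IHl]; first by rewrite big_geq // expr0 invr1; lra.
  by rewrite big_nat_recr //= IHl (exprS 2 l) invfM; lra.
pose F t n := eps n * x n * cos (2 * pi * n%:R * t + phi n).
apply: (@uniform_cauchy_continuous_limit R (fun N t => \sum_(0 <= n < N) F t n)).
  elim=> [|N IHN].
    rewrite (_ : (fun t => _) = cst 0); first exact: cst_continuous.
    by apply/funext => t; rewrite big_geq.
  rewrite (_ : (fun t => _) = (fun t => \sum_(0 <= n < N) F t n + F t N)); last first.
    by apply/funext => t; rewrite big_nat_recr.
  move=> t; apply: cvgD; first exact: IHN.
  apply: cvgM; first exact: cvg_cst.
  apply: (@continuous_comp R R R (fun t => 2 * pi * N%:R * t + phi N) cos);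
    last exact: continuous_cos.
  apply: cvgD; last exact: cvg_cst.
  by apply: cvgM; [exact: cvg_cst|exact: cvg_id].
move=> e e0; have [k1 tail] := small_tails B0 Bc e0.
pose k := maxn k0 k1.
exists (block_start k) => M t kM t01.
have -> : \sum_(0 <= n < M) F t n - \sum_(0 <= n < block_start k) F t n =
    \sum_(block_start k <= n < M) F t n.
  by rewrite (big_cat_nat (leq0n _) kM) /= addrAC subrr add0r.
have starts : {homo block_start : i j / (i <= j)%N}.
  by move=> i j ij; rewrite /block_start !leq_exp2l.
have Mk : (M <= block_start (k + M))%N.
  rewrite (leq_trans (ltnW (ltn_expl M (ltnSn 1)))) // leq_exp2l //.
  by rewrite (leq_trans (ltnW (ltn_expl M (ltnSn 1)))) // leq_exp2l // leq_addl.
apply: (@le_trans _ _ (\sum_(k <= j < k + M) B j)).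
  apply: (@telescope_blocks R (F t) block_start B) => //; last by rewrite kM.
  move=> j m kj jm.
  have th : 0 <= 2 * pi * t <= 8.
    move: t01; rewrite in_itv /= => /andP[t0 t1].
    have p0 := pi_ge0 R; have p4 : pi <= 4 :> R by have := pihalf_lt2 R; lra.
    by nra.
  have k0j : (k0 <= j)%N := leq_trans (leq_maxl k0 k1) kj.
  have := @block_sum_le R x phi Hdecr p q alpha j (pqE j) (passed j k0j)
    m (2 * pi * t) jm th.
  rewrite (eq_bigr (F t)) => [|n _]; last first.
    rewrite /F epsE /rademacher_sign.
    by rewrite (_ : n%:R * (2 * pi * t) = 2 * pi * n%:R * t) //; ring.
  move=> /le_trans; apply; rewrite lerD2l ler_wpM2l ?addr_ge0 //.
  rewrite lef_pV2 ?posrE ?exprn_gt0 ?ltr0n ?expn_gt0 //.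
  by rewrite -natrX ler_nat exp2_le_block_end.
apply: le_trans (tail (k + M)%N _); last first.
  by rewrite (leq_trans (leq_maxr k0 k1)) ?leq_addr.
rewrite [leRHS](big_cat_nat (leq_maxr k0 k1) (leq_addr M k)) /=.
by rewrite lerDr sumr_ge0.
Qed.
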